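(* Let $p>1/2$ be a constant and let $X=V(M)_p$. Then there exists a constant $c>0$ such that, with probability $1-o(1/k)$ as $k\to\infty$, every closed, 2-linked $A\subseteq L_k$ (or $A\subseteq L_{k-1}$) with $1<|A|$ and $|N(A)|\ge(1+1/(2k))|A|$ satisfies \[|N(A)\cap X|-|A\cap X|\ge c\,(|N(A)|-|A|).\]
   Context: $M$ is the ''middle two layers'' graph: the bipartite graph with parts $L_k=\binom{[2k-1]}{k}$ and $L_{k-1}=\binom{[2k-1]}{k-1}$ (sets of size $k$ and $k-1$ of $\{1,\dots,2k-1\}$), where $u\in L_k$ and $v\in L_{k-1}$ are adjacent iff $v\subseteq u$. $X=V(M)_p$ is the random subset of $V(M)$ containing each vertex independently with probability $p$. $N(A)$ denotes the neighborhood of $A$ in $M$. For $A$ contained in one side $Y$ of the bipartition: $A$ is closed if there is no $A'\subseteq Y$ with $A'\supsetneq A$ and $N(A')=N(A)$; $A$ is 2-linked if there is no $B\subsetneq A$ such that $N(B)$ is disjoint from $N(A\setminus B)$ (equivalently, $A\cup N(A)$ induces a connected subgraph of $M$). *)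

(* Defs.v *)
From mathcomp Require Import all_boot all_order all_algebra.
From mathcomp Require Import reals.

Set Implicit Arguments.
Unset Strict Implicit.
Unset Printing Implicit Defensive.

Import Order.TTheory GRing.Theory Num.Theory.

Local Open Scope ring_scope.

Section Graph.
Variables (T : finType) (e : rel T).

Definition nbhd (A : {set T}) : {set T} :=
  [set v | [exists u in A, e u v]].

Definition nbhd_closed (Y A : {set T}) : bool :=
  ~~ [exists A' : {set T},
        [&& A' \subset Y, A \proper A' & nbhd A' == nbhd A]].

(* B must be nonempty: B = set0 would separate every nonempty A. *)
Definition two_linked (A : {set T}) : bool :=
  ~~ [exists B : {set T},
        [&& B != set0, B \proper A & [disjoint nbhd B & nbhd (A :\: B)]]].

End Graph.

(* The ground set [2k-1] is 'I_(2 * k - 1); as subtraction is truncated, the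
   definitions below are meaningful for k >= 1 only. *)
Definition layer (k i : nat) : {set {set 'I_(2 * k - 1)}} :=
  [set u : {set 'I_(2 * k - 1)} | #|u| == i].

Definition upper (k : nat) := layer k k.
Definition lower (k : nat) := layer k k.-1.

Definition vertices (k : nat) : {set {set 'I_(2 * k - 1)}} :=
  upper k :|: lower k.

Definition adj (k : nat) : rel {set 'I_(2 * k - 1)} :=
  fun u v => [&& u \in upper k, v \in lower k & v \subset u]
          || [&& v \in upper k, u \in lower k & u \subset v].
Arguments adj : clear implicits.

(* Probability that V_p satisfies E, where V_p contains each element of V
   independently with probability p: a set X included in V has weight
   p ^ #|X| * (1 - p) ^ #|V \ X|. *)
Definition Prob_subset (R : realType) (T : finType) (V : {set T}) (p : R)
    (E : pred {set T}) : R :=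
  \sum_(X in powerset V | E X) p ^+ #|X| * (1 - p) ^+ #|V :\: X|.

Definition expanding_event (R : realType) (k : nat) (c : R)
    (X : {set {set 'I_(2 * k - 1)}}) : bool :=
  [forall Y in [:: upper k; lower k],
   forall A : {set {set 'I_(2 * k - 1)}},
     [&& A \subset Y, nbhd_closed (adj k) Y A, two_linked (adj k) A,
         (1 < #|A|)%N &
         (1 + (2 * k%:R)^-1) * #|A|%:R <= #|nbhd (adj k) A|%:R :> R]
     ==> (c * (#|nbhd (adj k) A|%:R - #|A|%:R)
            <= #|nbhd (adj k) A :&: X|%:R - #|A :&: X|%:R)].

(* Main.v *)
(** Let [f] be the indicator of [X] minus [p], [G = N(A)] and [t = |G| - |A|]; one
    has to bound the sum of [f] over [G] minus its sum over [A] from below by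
    [- (p - c) t], for all [A] at once.  The graph enters only as a [k]-regular
    subgraph of the cube of dimension [n <= 2 k].

    If [t < K k] then [A] has boundedly many elements, and [|G| >= 2 k - 2]; since
    there are at most [4^k k^O(1)] linked sets of bounded size, a Chernoff bound with
    base close to [1 - p < 1/2] suffices.

    If [t >= K k], Sapozhenko's method yields [exp (o t)] pairs [(F, S)] such that
    every [A] has one with [F] in [G], [A] in [S], [|S| - |F|] at most a small multiple
    of [t], and [|G \ F|], [|S \ A|] at most [2 t].  The pair is read off from a set of
    [o (t / log k)] vertices, which is linked, hence contained in a short cube walk.

    Large sets with small boundary are handled by smoothing with the averaging
    operator [P]: if [h] is the indicator of [G] minus that of [A], then [h + P h] has
    norm [2 t] in l1, so [h - P^4 h] has l1 norm O(t) and <f, h - P^4 h> deviates by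
    [eps t] with probability [exp (- c t)] only, while <f, P^4 h> = <P^4 f, h> is
    negligible because [P^4 f] is uniformly [o (1 / k)].  The same applies to the
    pairs [(F, S)].

    It remains to treat [D = S \ A] and [E = G \ F].  They cover all edges between
    [S] and the complement of [F].  Take a maximal matching of that bipartite graph,
    with [mu] edges.  If [mu] is at least a small multiple of [t], then [D] and [E]
    have at least [(2 p - 1 - o(1)) mu] points in [X], since [p > 1/2].  Otherwise [A]
    is determined by [(F, S)] and the trace of [D] and [E] on the matching, so there
    are few candidates for [A] and concentration applies to [A] itself. *)

Require Import Defs.
From mathcomp Require Import all_boot all_order all_algebra.
From mathcomp Require Import ring lra zify.

Set Implicit Arguments.
Unset Strict Implicit.
Unset Printing Implicit Defensive.

Import Order.TTheory GRing.Theory Num.Theory.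

(** * Cube graphs *)

Lemma card_bigcup_le (I T : finType) (P : {set I}) (F : I -> {set T}) :
  #|\bigcup_(i in P) F i| <= \sum_(i in P) #|F i|.
Proof.
apply: (big_ind2 (fun (B : {set T}) m => #|B| <= m)) => //; first by rewrite cards0.
by move=> B1 m1 B2 m2 h1 h2; apply: leq_trans (leq_card_setU _ _) (leq_add h1 h2).
Qed.

Section Cube.
Variable n : nat.
Implicit Types (x y z : {set 'I_n}) (i : 'I_n).

Definition sdiff x y : {set 'I_n} := [set i | (i \in x) (+) (i \in y)].
Definition dist x y := #|sdiff x y|.
Definition tog x i := sdiff x [set i].

Lemma sdiffC x y : sdiff x y = sdiff y x.
Proof. by apply/setP => i; rewrite !inE addbC. Qed.

Lemma distC x y : dist x y = dist y x.
Proof. by rewrite /dist sdiffC. Qed.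

Lemma sdiffA x y z : sdiff x (sdiff y z) = sdiff (sdiff x y) z.
Proof. by apply/setP => i; rewrite !inE addbA. Qed.

Lemma sdiffxx x : sdiff x x = set0.
Proof. by apply/setP => i; rewrite !inE addbb. Qed.

Lemma sdiff0 x : sdiff x set0 = x.
Proof. by apply/setP => i; rewrite !inE addbF. Qed.

Lemma sdiffK x y : sdiff x (sdiff x y) = y.
Proof. by rewrite sdiffA sdiffxx sdiffC sdiff0. Qed.

Lemma dist0 x y : (dist x y == 0) = (x == y).
Proof.
rewrite cards_eq0; apply/eqP/eqP => [h|->]; last exact: sdiffxx.
by rewrite -(sdiffK x y) h sdiff0.
Qed.

Lemma distxx x : dist x x = 0.
Proof. by apply/eqP; rewrite dist0. Qed.

Lemma dist_triangle y x z : dist x z <= dist x y + dist y z.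
Proof.
apply: leq_trans (leq_card_setU _ _); apply: subset_leq_card.
apply/subsetP => i; rewrite !inE.
by case: (i \in x); case: (i \in y); case: (i \in z).
Qed.

Lemma dist1P x y : dist x y = 1 -> exists i, y = tog x i.
Proof.
move/eqP/cards1P => [i hi]; exists i.
by rewrite /tog -hi sdiffK.
Qed.

Lemma togK i : involutive (tog^~ i).
Proof. by move=> x; rewrite /tog -sdiffA sdiffxx sdiff0. Qed.

Lemma tog_inj x : injective (tog x).
Proof.
move=> i j h; apply/set1P; rewrite -(sdiffK x [set j]) -/(tog x j) -h.
by rewrite sdiffK set11.
Qed.

Lemma dist_tog x y i :
  dist (tog x i) y = if i \in sdiff x y then (dist x y).-1 else (dist x y).+1.
Proof.
have -> : dist (tog x i) y = #|sdiff (sdiff x y) [set i]|.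
  by rewrite /dist /tog -!sdiffA (sdiffC [set i]).
rewrite /dist; move: (sdiff x y) => s; case: ifP => hi.
  rewrite (cardsD1 i s) hi /=; congr #|pred_of_set _|.
  by apply/setP => j; rewrite !inE; case: eqP => [->|_]; rewrite ?addbF // hi.
rewrite (_ : sdiff s [set i] = i |: s) ?cardsU1 ?hi //.
by apply/setP => j; rewrite !inE; case: eqP => [->|_]; rewrite ?addbF // hi.
Qed.

Lemma card_ball1 x : #|[set y | dist x y == 1]| <= n.
Proof.
rewrite -[X in _ <= X]card_ord -(card_imset _ (@tog_inj x)).
apply: subset_leq_card; apply/subsetP => y; rewrite inE => /eqP /dist1P [i ->].
exact: imset_f.
Qed.

Lemma card_sphere2 x : #|[set y | dist x y == 2]| <= n * n.
Proof.
have -> : n * n = #|{: 'I_n * 'I_n}| by rewrite card_prod !card_ord.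
pose f (ij : 'I_n * 'I_n) := tog (tog x ij.1) ij.2.
apply: leq_trans (leq_imset_card f _); apply: subset_leq_card.
apply/subsetP => y; rewrite inE => hy.
have /card_gt0P [i hi] : 0 < dist x y by rewrite (eqP hy).
have /dist1P [j hj] : dist (tog x i) y = 1 by rewrite dist_tog hi (eqP hy).
by apply/imsetP; exists (i, j).
Qed.

End Cube.

(** * Edge counting in regular subgraphs of the cube *)

Section CubeGraph.
Variables (n k : nat) (e : rel {set 'I_n}) (V : {set {set 'I_n}}).
Implicit Types (x y z u v w : {set 'I_n}) (A B : {set {set 'I_n}}).

Definition nbrs x : {set {set 'I_n}} := [set y | e x y].
Definition degree A x := #|nbrs x :&: A|.

(** All that is kept of the middle layers graph: regularity and the cube metric. Both sides of the
    bipartition are then treated by the same lemmas. *)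
Record cube_graph : Prop := CubeGraph {
  cg_sym : symmetric e;
  cg_dist : forall x y, e x y -> dist x y = 1;
  cg_sub : forall x y, e x y -> x \in V;
  cg_reg : forall x, x \in V -> #|nbrs x| = k }.

Hypothesis H : cube_graph.

Lemma nbC x y : (x \in nbrs y) = (y \in nbrs x).
Proof. by rewrite !inE (cg_sym H). Qed.

Lemma nb_dist x y : y \in nbrs x -> dist x y = 1.
Proof. by rewrite inE => /(cg_dist H). Qed.

Lemma nb_sub x : nbrs x \subset V.
Proof. by apply/subsetP => y; rewrite inE (cg_sym H) => /(cg_sub H). Qed.

Lemma deg_le A x : degree A x <= k.
Proof.
have [hx|hx] := boolP (x \in V).
  by rewrite -(cg_reg H hx); apply/subset_leq_card/subsetIl.
rewrite /degree; suff -> : nbrs x = set0 by rewrite set0I cards0.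
by apply/setP => y; rewrite !inE; apply: contraNF hx => /(cg_sub H).
Qed.

Lemma nbhdE A v : (v \in nbhd e A) = [exists u in A, u \in nbrs v].
Proof.
by rewrite inE; apply: eq_existsb => u; rewrite inE (cg_sym H).
Qed.

Lemma nbhdP A v : reflect (exists2 u, u \in A & v \in nbrs u) (v \in nbhd e A).
Proof.
rewrite nbhdE; apply: (iffP existsP) => [[u /andP[uA h]]|[u uA h]]; exists u => //.
  by rewrite nbC.
by rewrite uA nbC.
Qed.

Lemma nb_nbhd A u : u \in A -> nbrs u \subset nbhd e A.
Proof. by move=> uA; apply/subsetP => v hv; apply/nbhdP; exists u. Qed.

Lemma nbhd_sub A : nbhd e A \subset V.
Proof. by apply/subsetP => v /nbhdP [u _]; apply/subsetP/nb_sub. Qed.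

Lemma nbhdS A B : A \subset B -> nbhd e A \subset nbhd e B.
Proof.
move=> /subsetP AB; apply/subsetP => v /nbhdP [u uA hv].
by apply/nbhdP; exists u => //; apply: AB.
Qed.

Lemma deg_sum A B : \sum_(x in A) degree B x = \sum_(y in B) degree A y.
Proof.
have E C D : \sum_(x in C) degree D x = \sum_(x in C) \sum_(y in D) (e x y : nat).
  apply: eq_bigr => x _; rewrite /degree -sum1_card big_mkcond /= [RHS]big_mkcond /=.
  by apply: eq_bigr => y _; rewrite !inE; case: (e x y); case: (y \in D).
rewrite !E exchange_big /=; apply: eq_bigr => y _; apply: eq_bigr => x _.
by rewrite (cg_sym H).
Qed.

(** Distinct vertices with a common neighbour are at distance 2, and that neighbour arises by
    flipping one of the two coordinates in which they differ. *)
Lemma codeg x y : x != y -> #|nbrs x :&: nbrs y| <= 2.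
Proof.
move=> xy; have [->|[z0]] := set_0Vmem (nbrs x :&: nbrs y); first by rewrite cards0.
have step z : z \in nbrs x :&: nbrs y -> dist x y = 2 /\ z \in [set tog x i | i in sdiff x y].
  rewrite inE => /andP[/nb_dist/dist1P[i ->]]; rewrite nbC => /nb_dist.
  rewrite dist_tog; case: ifP => hi h; first by split; [lia|apply: imset_f].
  by move/eqP: xy; case; apply/eqP; rewrite -dist0; lia.
move=> /step [d2 _]; rewrite -d2; apply: leq_trans (leq_imset_card (tog x) _).
by apply: subset_leq_card; apply/subsetP => z /step [].
Qed.

Lemma deg_full A u : u \in V -> nbrs u \subset A -> degree A u = k.
Proof. by move=> uV /setIidPl h; rewrite /degree h (cg_reg H). Qed.

Lemma deg_gt0 A v : (0 < degree A v) = (v \in nbhd e A).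
Proof.
rewrite nbhdE card_gt0; apply/set0Pn/existsP => -[u]; first by rewrite inE andbC; exists u.
by exists u; rewrite inE andbC.
Qed.

Section Bdry.
Variable A : {set {set 'I_n}}.
Hypothesis AV : A \subset V.
Let G := nbhd e A.

Lemma sum_deg_nbhd : \sum_(v in G) degree A v = k * #|A|.
Proof.
rewrite deg_sum (eq_bigr (fun=> k)) ?sum_nat_const 1?mulnC // => u uA.
by rewrite deg_full ?nb_nbhd // (subsetP AV).
Qed.

(** The sum counts the edges at [N A] that miss [A]. With [t = |N A| - |A|] there are exactly [k t]
    of them; this budget pays for all exceptional vertices below. *)
Lemma sum_codeg_nbhd : \sum_(v in G) (k - degree A v) = k * #|G| - k * #|A|.
Proof.
rewrite -sum_deg_nbhd mulnC -sum_nat_const -sumnB // => v _; exact: deg_le.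
Qed.

Lemma card_le_nbhd : 0 < k -> #|A| <= #|G|.
Proof.
move=> k0; rewrite -(leq_pmul2l k0) -sum_deg_nbhd mulnC -sum_nat_const.
by apply: leq_sum => v _; apply: deg_le.
Qed.

Let t := #|G| - #|A|.

Lemma low_count c B : B \subset G -> (forall v, v \in B -> degree A v + c <= k) ->
  #|B| * c <= k * t.
Proof.
move=> BG h; rewrite /t mulnBr -sum_codeg_nbhd -sum_nat_const.
rewrite [X in _ <= X](big_setID B) /= (setIidPr BG); apply: leq_trans (leq_addr _ _).
by apply: leq_sum => v /h; lia.
Qed.

(** The same budget of [k t] edges seen from the other end: each vertex of [B] receives at least [c]
    edges from [N A], and none of them ends in [A]. *)
Lemma out_count c B : [disjoint B & A] -> B \subset V ->
  (forall u, u \in B -> c <= degree G u) -> #|B| * c <= k * t.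
Proof.
move=> BA BV h; rewrite /t mulnBr -sum_nat_const.
have GV : G \subset V := nbhd_sub A.
have -> : k * #|G| = \sum_(u in V) degree G u.
  rewrite deg_sum mulnC -sum_nat_const; apply: eq_bigr => v vG.
  by rewrite deg_full ?nb_sub // (subsetP GV).
have -> : k * #|A| = \sum_(u in A) degree G u.
  rewrite mulnC -sum_nat_const; apply: eq_bigr => v vG.
  by rewrite deg_full ?nb_nbhd // (subsetP AV).
rewrite [X in _ <= X - _](big_setID A) /= (setIidPr AV) addnC addnK.
rewrite [X in _ <= X](big_setID B) /=; have -> : (V :\: A) :&: B = B.
  apply/setIidPr/subsetP => u uB; rewrite inE (subsetP BV) // andbT.
  by rewrite (disjointFr BA).
by apply: leq_trans (leq_addr _ _); apply: leq_sum.
Qed.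

End Bdry.

(** The neighbours of [w] in [A] emit [k] edges each. At most [k] of these return to [w], and by
    [codeg] any other vertex absorbs at most two. *)
Lemma card_nbhd_far A w : w \in V -> A \subset V ->
  k * degree A w <= k + 2 * #|nbhd e (nbrs w :&: A) :\ w|.
Proof.
move=> wV AV; set U := nbrs w :&: A.
have UV : U \subset V by apply: subset_trans AV; apply: subsetIr.
rewrite -(sum_deg_nbhd UV).
have h v : v != w -> degree U v <= 2.
  move=> vw; apply: leq_trans (codeg vw); apply: subset_leq_card.
  by rewrite /degree /U setIA subsetIl.
have := deg_le U w => hw.
have [wN|wN] := boolP (w \in nbhd e U).
  rewrite (big_setD1 w) //=; apply: leq_add => //.
  rewrite mulnC -sum_nat_const; apply: leq_sum => v; rewrite !inE => /andP[vw _]; exact: h.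
apply: leq_trans (leq_addl _ _); rewrite mulnC -sum_nat_const.
have -> : nbhd e U :\ w = nbhd e U.
  by apply/setDidPl; rewrite disjoint_sym disjoints1.
by apply: leq_sum => v vN; apply: h; apply: contraNneq wN => <-.
Qed.

(** Vertices are added one at a time; by [codeg] a new one shares at most two neighbours with each
    earlier one, which sums to [|A| (|A| - 1)]. *)
Lemma card_nbhd_small A : A \subset V -> #|A| * k <= #|nbhd e A| + #|A| * #|A|.-1.
Proof.
have [m] := ubnP #|A|; elim: m A => // m IH A hm AV.
have [->|[u uA]] := set_0Vmem A; first by rewrite cards0.
have hc := cardsD1 u A; rewrite uA /= add1n in hc.
have hcm : #|A :\ u| < m by rewrite -hc.
have := IH (A :\ u) hcm (subset_trans (subsetDl _ _) AV).
set B := A :\ u in hc *; move=> hB.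
have hN : #|nbhd e A| >= #|nbhd e B| + #|nbrs u :\: nbhd e B|.
  rewrite -cardsUI (_ : _ :&: _ = set0) ?cards0 ?addn0.
    apply: subset_leq_card; rewrite subUset nbhdS ?subsetDl //=.
    by apply: subset_trans (subsetDl _ _) _; apply: nb_nbhd.
  by apply/setP => z; rewrite !inE; case: [exists _ in _, _]; rewrite ?andbF.
have hI : #|nbrs u :&: nbhd e B| <= 2 * #|B|.
  apply: (@leq_trans #|\bigcup_(w in B) (nbrs u :&: nbrs w)|).
    apply: subset_leq_card; apply/subsetP => z; rewrite inE => /andP[zu /nbhdP[w wB zw]].
    by apply/bigcupP; exists w => //; rewrite inE zu.
  apply: leq_trans (card_bigcup_le _ _) _; rewrite mulnC -sum_nat_const.
  apply: leq_sum => w; rewrite !inE => /andP[wu _]; apply: codeg; by rewrite eq_sym.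
have := cardsID (nbhd e B) (nbrs u); rewrite (cg_reg H (subsetP AV _ uA)).
move: hB hI hN; rewrite hc /=.
move: #|nbrs u :\: nbhd e B| #|nbrs u :&: nbhd e B| #|B| => z w.
move: #|nbhd e B| #|nbhd e A| => x y.
by case=> [|b] /=; rewrite ?mulSn ?mulnS; lia.
Qed.

End CubeGraph.

(** * Greedy covers and linked sets *)

Section Greedy.
Variable T : finType.
Implicit Types (C W Z U : {set T}) (N : T -> {set T}).

Lemma sum_cardI_le (B : T -> {set T}) C Z m :
  (forall w, w \in Z -> #|[set v in C | w \in B v]| <= m) ->
  \sum_(v in C) #|B v :&: Z| <= m * #|Z|.
Proof.
move=> h; have E : \sum_(v in C) #|B v :&: Z| = \sum_(w in Z) #|[set v in C | w \in B v]|.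
  transitivity (\sum_(v in C) \sum_(w in Z) (w \in B v : nat)).
    apply: eq_bigr => v _; rewrite -sum1_card big_mkcond [RHS]big_mkcond /=.
    by apply: eq_bigr => w _; rewrite !inE; case: (w \in B v); case: (w \in Z).
  rewrite exchange_big /=; apply: eq_bigr => w _.
  rewrite -sum1_card big_mkcond [RHS]big_mkcond /=.
  by apply: eq_bigr => v _; rewrite !inE; case: (w \in B v); case: (v \in C).
by rewrite E mulnC -sum_nat_const; apply: leq_sum.
Qed.

(** While some [u] in [C] still has [s] uncovered points of [Z] in [N u], it is added to [T1]. Every
    addition uses up [s] points of [Z]. *)
Lemma greedy_saturate N s C Z : 0 < s ->
  exists T1 : {set T}, [/\ T1 \subset C, #|T1| * s <= #|Z| &
    forall u, u \in C -> #|(N u :&: Z) :\: \bigcup_(x in T1) N x| < s].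
Proof.
move=> s0; have [m] := ubnP #|Z|; elim: m Z => // m IH Z hm.
have [/exists_inP[u uC hu]|/exists_inPn h] := boolP [exists u in C, s <= #|N u :&: Z|].
  have hZ := cardsID (N u) Z; rewrite setIC in hZ.
  have [|T1 [h1 h2 h3]] := IH (Z :\: N u); first by lia.
  exists (u |: T1); split.
  - by rewrite subUset sub1set uC.
  - have := (leq_card_setU [set u] T1).1; rewrite cards1 -(leq_pmul2r s0) mulnDl => h.
    by apply: leq_trans h _; lia.
  - move=> w /h3; apply: leq_ltn_trans; apply: subset_leq_card.
    apply/subsetP => z; rewrite bigcup_setU big_set1 !inE negb_or.
    by case/andP => /andP[-> ->] /andP[-> ->].
exists set0; split; rewrite ?sub0set ?cards0 //.
by move=> u /h; rewrite big_set0 setD0 -ltnNge.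
Qed.

(* As long as half of [W] is uncovered, some [N v] covers a fraction [b / #|C|]
   of the uncovered part. *)
Lemma greedy_half N b C W : 0 < b ->
  (forall w, w \in W -> b <= #|[set v in C | w \in N v]|) ->
  exists T1 : {set T}, [/\ T1 \subset C, #|T1| <= (#|C| %/ b).+1 &
    2 * #|W :\: \bigcup_(x in T1) N x| <= #|W|].
Proof.
move=> b0 hW.
have step i : exists T1 : {set T}, [/\ T1 \subset C, #|T1| <= i &
    2 * #|W :\: \bigcup_(x in T1) N x| <= #|W| \/
    i * (#|W| * b) <= 2 * #|C| * (#|W| - #|W :\: \bigcup_(x in T1) N x|)].
  elim: i => [|i [T1 [h1 h2 h3]]].
    by exists set0; split; rewrite ?sub0set ?cards0 //; right.
  case: h3 => h3; first by exists T1; split => //; [lia|left].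
  set U := W :\: _ in h3.
  have [hU|hU] := leqP (2 * #|U|) #|W|; first by exists T1; split => //; [lia|left].
  have [v vC hv] : exists2 v, v \in C & #|U| * b <= #|N v :&: U| * #|C|.
    apply/exists_inP; apply: contraT => /exists_inPn hno.
    have hs : #|U| * b <= \sum_(v in C) #|N v :&: U|.
      rewrite -sum_nat_const.
      apply: (@leq_trans (\sum_(w in U) #|[set v in C | w \in N v]|)).
        by apply: leq_sum => w; rewrite inE => /andP[_ /hW].
      have -> : \sum_(v in C) #|N v :&: U| = \sum_(v in C) \sum_(w in U) (w \in N v : nat).
        apply: eq_bigr => v _; rewrite -sum1_card big_mkcond [RHS]big_mkcond /=.
        by apply: eq_bigr => w _; rewrite inE; case: (w \in N v); case: (w \in U).
      rewrite exchange_big /=; apply: leq_sum => w _; apply: eq_leq.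
      rewrite -sum1_card big_mkcond [RHS]big_mkcond /=.
      by apply: eq_bigr => v _; rewrite !inE; case: (w \in N v); case: (v \in C).
    have [w wU] : exists w, w \in U by apply/card_gt0P; lia.
    have C0 : 0 < #|C|.
      have wW : w \in W by move: wU; rewrite inE => /andP[].
      apply: leq_trans b0 (leq_trans (hW _ wW) _); apply: subset_leq_card.
      by apply/subsetP => v; rewrite inE => /andP[].
    have : #|C| * \sum_(v in C) #|N v :&: U| < #|C| * (#|U| * b).
      rewrite big_distrr /= -sum_nat_const.
      have [v0 v0C] := card_gt0P C0.
      rewrite (bigD1 v0) //= [X in _ < X](bigD1 v0) //= -addSn; apply: leq_add.
        by have := hno _ v0C; rewrite -ltnNge mulnC.
      apply: leq_sum => v /andP[vC _]; apply: ltnW.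
      by have := hno _ vC; rewrite -ltnNge mulnC.
    by nia.
  exists (v |: T1); split; first by rewrite subUset sub1set vC.
    by have := (leq_card_setU [set v] T1).1; rewrite cards1; lia.
  right; have -> : W :\: \bigcup_(x in v |: T1) N x = U :\: N v.
    apply/setP => z; rewrite bigcup_setU big_set1 !inE negb_or.
    by rewrite andbA.
  have hc := cardsID (N v) U; rewrite setIC in hc.
  have UW : #|U| <= #|W| by apply/subset_leq_card/subsetDl.
  by nia.
have [T1 [h1 h2 [h3|h3]]] := step (#|C| %/ b).+1; first by exists T1.
have [W0|W0] := posnP #|W|.
  exists set0; split; rewrite ?sub0set ?cards0 // W0 leqn0 muln_eq0 /=.
  by rewrite -leqn0 -[X in _ <= X]W0; apply/subset_leq_card/subsetDl.
exists T1; split => //; rewrite leqNgt; apply/negP => hlt.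
have := divn_eq #|C| b; have := ltn_pmod #|C| b0; set q := #|C| %/ b in h3 *.
move: #|W :\: _| h3 hlt => x h3 hlt.
move=> hr hq; have : #|C| < q.+1 * b by rewrite mulSn; lia.
move: h3; move: (#|C|) => c h3 {hr hq} hc; nia.
Qed.

Lemma greedy_cover N b j C W : 0 < b ->
  (forall w, w \in W -> b <= #|[set v in C | w \in N v]|) ->
  exists T1 : {set T}, [/\ T1 \subset C, #|T1| <= j * (#|C| %/ b).+1 &
    2 ^ j * #|W :\: \bigcup_(x in T1) N x| <= #|W|].
Proof.
move=> b0 hW; elim: j => [|j [T1 [h1 h2 h3]]].
  by exists set0; rewrite sub0set cards0 big_set0 setD0 mul1n.
set U := W :\: _ in h3.
have [w|T2 [g1 g2 g3]] := @greedy_half N b C U b0.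
  by rewrite inE => /andP[_ /hW].
exists (T1 :|: T2); split; first by rewrite subUset h1.
  by rewrite mulSn addnC; apply: leq_trans (leq_card_setU _ _).1 (leq_add h2 g2).
have -> : W :\: \bigcup_(x in T1 :|: T2) N x = U :\: \bigcup_(x in T2) N x.
  by apply/setP => z; rewrite bigcup_setU !inE negb_or -andbA andbCA.
by rewrite expnS; nia.
Qed.

End Greedy.

(** * Encoding linked sets by cube walks *)

Section Walks.
Variable n : nat.
Implicit Types (x y : {set 'I_n}) (s d : seq 'I_n) (Q C : {set {set 'I_n}}).

Definition visited x s := x :: scanl (@tog n) x s.

Lemma foldl_tog_uniq x d : uniq d -> foldl (@tog n) x d = sdiff x [set i in d].
Proof.
elim: d x => [|i d IH] x /=; first by rewrite (_ : [set _ in _] = set0) ?sdiff0 //; apply/setP => i; rewrite !inE.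
case/andP => hi /IH ->; rewrite /tog -sdiffA; congr sdiff.
by apply/setP => j; rewrite !inE; case: eqP => [->|_] //=; rewrite (negbTE hi).
Qed.

Lemma foldl_togK x d : foldl (@tog n) (foldl (@tog n) x d) (rev d) = x.
Proof. by elim: d x => //= i d IH x; rewrite rev_cons foldl_rcons IH togK. Qed.

Lemma visited_cat x s d :
  visited x (s ++ d) = visited x s ++ scanl (@tog n) (foldl (@tog n) x s) d.
Proof. by rewrite /visited scanl_cat. Qed.

Lemma mem_visited_foldl x s : foldl (@tog n) x s \in visited x s.
Proof.
elim: s x => [|i s IH] x /=; first exact: mem_head.
by rewrite inE; apply/orP; right; apply: IH.
Qed.

Lemma visitedP x y s : y \in visited x s ->
  exists s1 s2, s = s1 ++ s2 /\ foldl (@tog n) x s1 = y.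
Proof.
elim: s x => [|i s IH] x; first by rewrite inE => /eqP ->; exists [::], [::].
rewrite inE => /orP[/eqP ->|]; first by exists [::], (i :: s).
by case/IH => s1 [s2 [-> <-]]; exists (i :: s1), s2.
Qed.

(* A walk is given by its start and the coordinates it flips; a new point is
   reached by a detour of at most [r] flips, which is then retraced. *)
Lemma linked_walk r Q x0 : x0 \in Q ->
  (forall C, C \subset Q -> x0 \in C -> C != Q ->
     exists x y, [/\ x \in C, y \in Q :\: C & dist x y <= r]) ->
  exists2 s, size s <= 2 * r * #|Q| & {subset Q <= visited x0 s}.
Proof.
move=> x0Q hl; pose cov s := [set x in Q | x \in visited x0 s].
suff step m : exists2 s, size s <= 2 * r * m & m < #|cov s| \/ cov s = Q.
  have [s hs] := step #|Q|; have hsub : cov s \subset Q by apply/subsetP => x; rewrite inE => /andP[].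
  case=> [|hQ]; first by have := subset_leq_card hsub; lia.
  by exists s => // x; rewrite -hQ inE => /andP[].
elim: m => [|m [s hs hc]].
  by exists [::] => //; left; apply/card_gt0P; exists x0; rewrite inE x0Q mem_head.
have [hQ|hQ] := eqVneq (cov s) Q; first by exists s; [lia|right].
case: hc => [hc|hc]; last by rewrite hc eqxx in hQ.
have [||x [y [xC yC hd]]] := hl (cov s) _ _ hQ.
- by apply/subsetP => x; rewrite inE => /andP[].
- by rewrite inE x0Q mem_head.
move: (xC); rewrite inE => /andP[_ /visitedP[s1 [s2 [hs12 hf]]]].
pose d := enum (sdiff x y).
have hy : foldl (@tog n) x d = y.
  rewrite foldl_tog_uniq ?enum_uniq // (_ : [set i in d] = sdiff x y) ?sdiffK //.
  by apply/setP => i; rewrite !inE mem_enum inE.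
exists (s1 ++ d ++ rev d ++ s2).
  rewrite !size_cat size_rev -cardE -/(dist x y).
  by move: hs; rewrite hs12 size_cat; lia.
left; apply: leq_trans (_ : #|y |: cov s| <= _).
  by move: yC; rewrite in_setD cardsU1 => /andP[-> _]; rewrite add1n.
have hyv : y \in visited x0 (s1 ++ d ++ rev d ++ s2).
  have -> : y = foldl (@tog n) x0 (s1 ++ d) by rewrite foldl_cat hf hy.
  by rewrite (catA s1 d) visited_cat mem_cat mem_visited_foldl.
apply: subset_leq_card; apply/subsetP => z.
rewrite in_setU1 /cov !in_set => /orP[/eqP ->|/andP[-> hz]].
  by move: yC; rewrite in_setD => /andP[_ ->].
move: hz; rewrite hs12 !visited_cat !mem_cat => /orP[->//|hz].
by rewrite !scanl_cat !mem_cat foldl_togK hz !orbT.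
Qed.

(** A walk of [l] flips visits [l.+1] points, counted with repetition, and the mask selects some of
    them. Such codes are cheap to count: the start, [l] coordinates and one bit per visited
    point. *)
Definition picked l (c : {set 'I_n} * l.-tuple 'I_n) (b : l.+1.-tuple bool) :
  {set {set 'I_n}} := [set z in mask b (visited c.1 c.2)].

Lemma linked_code r l Q : 0 < n -> 2 * r * #|Q| <= l ->
  (forall C, C \subset Q -> C != set0 -> C != Q ->
     exists x y, [/\ x \in C, y \in Q :\: C & dist x y <= r]) ->
  exists c : {set 'I_n} * l.-tuple 'I_n,
    forall T : {set {set 'I_n}}, T \subset Q -> exists b, picked c b = T.
Proof.
move=> n0 hl hlink; pose i0 := Ordinal n0.
have [->|[x0 x0Q]] := set_0Vmem Q.
  exists (set0, nseq_tuple l i0) => T; rewrite subset0 => /eqP ->.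
  exists (nseq_tuple l.+1 false); apply/setP => z; rewrite !inE.
  have h : forall (s : seq {set 'I_n}) m, mask (nseq m false) s = [::].
    by elim=> [|y s IH] [|m] //=; rewrite ?mask0.
  by have := h (set0 :: scanl (@tog n) set0 (nseq l i0)) l.+1 => /= ->.
have [|s hs hQ] := @linked_walk r Q x0 x0Q.
  by move=> C CQ x0C; apply: hlink => //; apply/set0Pn; exists x0.
(* The walk is padded by flips of an arbitrary coordinate, so that all codes have the same length
   [l]. *)
have hsz : size (s ++ nseq (l - size s) i0) == l.
  by rewrite size_cat size_nseq; apply/eqP; lia.
exists (x0, Tuple hsz) => T TQ.
pose vs := visited x0 (s ++ nseq (l - size s) i0).
have hb : size [seq z \in T | z <- vs] == l.+1.
  by rewrite size_map /= size_scanl (eqP hsz).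
exists (Tuple hb); apply/setP => z; rewrite inE -[mask _ _]/(mask [seq z \in T | z <- vs] vs) -filter_mask mem_filter.
case: (boolP (z \in T)) => //= zT.
by rewrite /vs visited_cat mem_cat hQ // (subsetP TQ).
Qed.

End Walks.

(** * Nets and second neighbourhoods of a set with small boundary *)

Section Structure.
Variables (n k : nat) (e : rel {set 'I_n}) (V : {set {set 'I_n}}).
Hypothesis H : cube_graph k e V.
Hypothesis k0 : 0 < k.
Implicit Types (x y z u v w : {set 'I_n}).
Variable A : {set {set 'I_n}}.
Hypothesis AV : A \subset V.

Local Notation nb := (nbrs e).
Local Notation deg := (degree e).
Local Notation G := (nbhd e A).
Local Notation t := (#|G| - #|A|).

Lemma nb_neq0 u : u \in V -> exists v, v \in nb u.
Proof. by move=> uV; apply/card_gt0P; rewrite (cg_reg H). Qed.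

(** If [C] and the rest of [Q] were further apart, the vertices of [N A] near the one and near the
    other would be at distance more than 2. No vertex of [A] would then have neighbours of both
    sorts, and [A] would split, against [two_linked]. *)
Lemma net_linked rho (Q : {set {set 'I_n}}) : two_linked e A ->
  (forall v, v \in G -> exists2 q, q \in Q & dist v q <= rho) ->
  (forall q, q \in Q -> exists2 v, v \in G & dist v q <= rho) ->
  forall C : {set {set 'I_n}}, C \subset Q -> C != set0 -> C != Q ->
  exists x y, [/\ x \in C, y \in Q :\: C & dist x y <= 2 * rho + 2].
Proof.
move=> hA hGQ hQG C CQ C0 CnQ.
pose near (D : {set {set 'I_n}}) := [set v in G | [exists q in D, dist v q <= rho]].
have nearP D v : v \in near D -> v \in G /\ exists2 q, q \in D & dist v q <= rho.
  by rewrite inE => /andP[-> /exists_inP].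
have [/existsP[v1 /existsP[v2 /and3P[h1 h2 h3]]]|hno] := boolP
  [exists v1, [exists v2, [&& v1 \in near C, v2 \in near (Q :\: C) & dist v1 v2 <= 2]]].
  have [_ [q1 q1C d1]] := nearP _ _ h1; have [_ [q2 q2C d2]] := nearP _ _ h2.
  exists q1, q2; split=> //.
  have := dist_triangle v1 q1 q2; have := dist_triangle v2 v1 q2.
  by rewrite (distC q1 v1); move: d1 d2 h3; clear; lia.
have far v1 v2 : v1 \in near C -> v2 \in near (Q :\: C) -> 2 < dist v1 v2.
  move=> h1 h2; rewrite ltnNge; apply: contra hno => h3.
  by apply/existsP; exists v1; apply/existsP; exists v2; rewrite h1 h2 h3.
have cov v : v \in G -> (v \in near C) || (v \in near (Q :\: C)).
  move=> vG; have [q qQ dq] := hGQ _ vG; rewrite !inE in vG *; rewrite vG /=.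
  have [qC|qC] := boolP (q \in C).
    by apply/orP; left; apply/exists_inP; exists q.
  by apply/orP; right; apply/exists_inP; exists q; rewrite // inE qC.
have nonempty (D : {set {set 'I_n}}) : D \subset Q -> D != set0 -> exists v, v \in near D.
  move=> DQ /set0Pn [q qD]; have [v vG dv] := hQG _ (subsetP DQ _ qD).
  by exists v; rewrite inE vG; apply/exists_inP; exists q.
have [v1 h1] := nonempty C CQ C0.
have [v2 h2] : exists v, v \in near (Q :\: C).
  apply: nonempty (subsetDl _ _) _; apply: contra CnQ.
  by rewrite setD_eq0 => hQ; rewrite eqEsubset CQ.
pose B := [set u in A | [exists v in near C, v \in nb u]].
case/negP: hA; apply/existsP; exists B.
have inB u v : u \in A -> v \in nb u -> v \in near C -> u \in B.
  by move=> uA vu hv; rewrite inE uA; apply/exists_inP; exists v.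
have notB u v : v \in nb u -> v \in near (Q :\: C) -> u \notin B.
  move=> vu hv; rewrite inE negb_and; apply/orP; right.
  apply/exists_inPn => w hw; apply/negP => wu.
  have := far _ _ hw hv; have := dist_triangle u w v.
  by rewrite (distC w u) (nb_dist H wu) (nb_dist H vu); clear; lia.
apply/and3P; split.
- have [v1G _] := nearP _ _ h1; have /(nbhdP H)[u uA hu] := v1G.
  by apply/set0Pn; exists u; apply: inB hu h1.
- apply/properP; split; first by apply/subsetP => u; rewrite inE => /andP[].
  have [v2G _] := nearP _ _ h2; have /(nbhdP H)[u uA hu] := v2G.
  by exists u => //; apply: notB hu h2.
- rewrite -setI_eq0; apply/eqP/setP => v; rewrite !inE; apply/negP.
  case/andP => hv1 hv2.
  have {}hv1 : v \in nbhd e B by rewrite inE.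
  have {}hv2 : v \in nbhd e (A :\: B) by rewrite inE.
  have /(nbhdP H)[u1 u1B hu1] := hv1; have /(nbhdP H)[u2 u2B hu2] := hv2.
  have u1A : u1 \in A by move: u1B; rewrite inE => /andP[].
  have vG : v \in G by apply/(nbhdP H); exists u1.
  move: u2B; rewrite in_setD => /andP[u2nB u2A].
  case/orP: (cov _ vG) => hv; first by rewrite (inB u2 v) in u2nB.
  by have := notB u1 v hu1 hv; rewrite u1B.
Qed.

Definition low := [set v in G | 2 * deg A v < k].

Lemma low_card : #|low| <= 2 * t.
Proof.
have := @low_count _ _ _ _ H A AV (uphalf k) low.
have hs : low \subset G by apply/subsetP => v; rewrite inE => /andP[].
have h v : v \in low -> deg A v + uphalf k <= k.
  by rewrite inE => /andP[_]; have := odd_double_half k; rewrite uphalf_half; lia.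
move=> /(_ hs h); have hk : k <= 2 * uphalf k.
  by have := odd_double_half k; rewrite uphalf_half; lia.
move: #|low| t => l s hl; rewrite -(leq_pmul2l k0); nia.
Qed.

(** The vertices reached from [w] by two steps through [A]; these sets are what the greedy choice of
    [T0] covers [N A] with. *)
Definition cov2 w := nbhd e (nb w :&: A).

Lemma cov2P w v : reflect (exists u, [/\ u \in A, w \in nb u & v \in nb u]) (v \in cov2 w).
Proof.
apply: (iffP (nbhdP H _ _)) => [[u]|[u [uA wu vu]]].
  by rewrite in_setI (nbC H u w) => /andP[wu uA] vu; exists u.
by exists u => //; rewrite in_setI (nbC H u w) wu uA.
Qed.

Lemma cov2C v w : (v \in cov2 w) = (w \in cov2 v).
Proof. by apply/cov2P/cov2P => -[u [uA h1 h2]]; exists u. Qed.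

Lemma cov2_sub w : cov2 w \subset G.
Proof. exact: nbhdS H _ _ (subsetIr _ _). Qed.

Lemma cov2_dist w v : v \in cov2 w -> v != w -> dist w v = 2.
Proof.
case/cov2P => u [uA hw hv] vw.
have /dist1P[i hi] := nb_dist H hv.
have := nb_dist H hw; rewrite distC => hwu.
have hd : dist v w = if i \in sdiff u w then (dist u w).-1 else (dist u w).+1.
  by rewrite hi dist_tog.
rewrite distC hd; case: ifP hd => // _ hd; first last.
  by rewrite distC hwu.
by move: vw; rewrite -dist0 hd distC hwu.
Qed.

(** A vertex that is not low has at least [k / 2] neighbours in [A], and [card_nbhd_far] turns them
    into about [k^2 / 4] second neighbours. *)
Lemma cov2_big w : w \in G -> w \notin low -> k * k <= 2 * k + 4 * #|cov2 w :\ w|.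
Proof.
move=> wG; rewrite inE wG /= -leqNgt => hd.
have wV := subsetP (nbhd_sub H A) _ wG.
have := card_nbhd_far H wV AV; rewrite -/(cov2 w).
by move: #|_| => c; nia.
Qed.

(** A maximal subset of [N A] with distances above 8 is a net, and its balls of radius 4 are
    disjoint. A ball around a centre within 2 of a vertex that is not low holds about [k^2 / 4]
    vertices of [N A], so there are at most [24 t / k] of these; any other ball holds [k] low
    vertices, of which there are at most [2 t] in all. *)
Lemma net_exists : 4 <= k -> #|G| <= 3 * k * t ->
  exists Q : {set {set 'I_n}}, [/\ Q \subset G,
    forall v, v \in G -> exists2 q, q \in Q & dist v q <= 8 & #|Q| * k <= 26 * t].
Proof.
move=> k4 hg.
pose sep (Q : {set {set 'I_n}}) := (Q \subset G) &&
  [forall v in Q, forall w in Q, (v != w) ==> (8 < dist v w)].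
have [Q /maxsetP[/andP[QG hQ] hmax]] : exists Q, maxset sep Q.
  have h0 : sep set0 by rewrite /sep sub0set; apply/forall_inP => v; rewrite inE.
  by have [Q hQ _] := maxset_exists h0; exists Q.
have sepQ v w : v \in Q -> w \in Q -> v != w -> 8 < dist v w.
  by move=> vQ wQ; move/forall_inP: hQ => /(_ _ vQ) /forall_inP /(_ _ wQ) /implyP.
exists Q; split => //.
  move=> v vG; apply/exists_inP; apply: contraT => /exists_inPn hno.
  have vnQ : v \notin Q by apply/negP => vQ; have := hno _ vQ; rewrite distxx.
  suff : v |: Q = Q by move=> hv; rewrite -hv setU11 in vnQ.
  apply: hmax; last exact: subsetUr.
  rewrite /sep subUset sub1set vG QG /=.
  apply/forall_inP => x; rewrite in_setU1 => hx.
  apply/forall_inP => y; rewrite in_setU1 => hy; apply/implyP => xy.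
  case/orP: hx xy => [/eqP ->|xQ]; case/orP: hy => [/eqP ->|yQ] xy.
  - by rewrite eqxx in xy.
  - by rewrite ltnNge hno.
  - by rewrite ltnNge distC hno.
  - exact: sepQ.
pose ball v := [set w | dist v w <= 4].
have disj (D Z : {set {set 'I_n}}) : D \subset Q -> \sum_(v in D) #|ball v :&: Z| <= #|Z|.
  move=> DQ; rewrite -[X in _ <= X]mul1n; apply: sum_cardI_le => w _.
  apply/card_le1_eqP => v1 v2; rewrite !inE => /andP[v1D d1] /andP[v2D d2].
  apply/eqP; apply: contraT => v12.
  have := sepQ _ _ (subsetP DQ _ v2D) (subsetP DQ _ v1D) v12.
  by have := dist_triangle w v2 v1; rewrite (distC w v1); move: d1 d2; clear; lia.
pose Q1 := [set v in Q | [exists w in G :\: low, dist v w <= 2]].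
have c1 : #|Q1| * k <= 24 * t.
  have h : #|Q1| * (k * k - 2 * k) <= 4 * #|G|.
    have Q1Q : Q1 \subset Q by apply/subsetP => v; rewrite inE => /andP[].
    apply: leq_trans (leq_mul (leqnn 4) (disj Q1 G Q1Q)).
    rewrite big_distrr -sum_nat_const /=; apply: leq_sum => v; rewrite inE => /andP[vQ].
    case/exists_inP => w; rewrite in_setD => /andP[wl wG] dvw.
    have := cov2_big wG wl.
    have : #|cov2 w :\ w| <= #|ball v :&: G|.
      apply: subset_leq_card; apply/subsetP => z; rewrite in_setD1 => /andP[zw zc].
      rewrite in_setI (subsetP (cov2_sub w)) // andbT inE.
      by have := cov2_dist zc zw; have := dist_triangle w v z; move: dvw; clear; lia.
    by move=> h1 h2; rewrite leq_subLR; apply: leq_trans h2 _; rewrite leq_add2l leq_mul2l.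
  move: #|Q1| t hg h => q s hg h.
  have h2 : q * (k * k) <= 8 * #|G| by nia.
  by rewrite -(leq_pmul2r k0); nia.
have c2 : #|Q :\: Q1| * k <= 2 * t.
  apply: leq_trans low_card.
  apply: leq_trans (disj (Q :\: Q1) low (subsetDl _ _)).
  rewrite -sum_nat_const; apply: leq_sum => v; rewrite in_setD => /andP[vQ1 vQ].
  have vG := subsetP QG _ vQ.
  have /(nbhdP H)[u uA vu] := vG.
  rewrite -(cg_reg H (subsetP AV _ uA)); apply: subset_leq_card.
  apply/subsetP => w wu; rewrite in_setI.
  have d2 : dist v w <= 2.
    have := dist_triangle u v w; rewrite (distC v u).
    by rewrite (nb_dist H vu) (nb_dist H wu).
  have wG : w \in G by apply: (subsetP (nb_nbhd H uA)).
  apply/andP; split; first by rewrite inE (leq_trans d2).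
  apply: contraT => wl; case/negP: vQ1; rewrite inE vQ; apply/exists_inP.
  by exists w => //; rewrite in_setD wl.
have := cardsID Q1 Q; have := subset_leq_card (subsetIr Q Q1).
by move: #|_| #|_| #|Q| #|_| c1 c2 => a b c d; nia.
Qed.

(* A vertex of [N A] with at least [k / 2] neighbours in [A] would have of order
   [k ^ 3] vertices of [A] within distance 3. *)
Lemma small_bdry K : n <= 2 * k -> (4 * K + 8) ^ 2 <= k -> t < K * k ->
  #|A| <= 2 * k * t -> #|A| < 4 * K + 2.
Proof.
move=> nk hk ht ha.
have [hl|/subsetPn [v0 v0G v0l]] := boolP (G \subset low).
  (* If all of [N A] is low, then [|N A| <= 2 t < 2 K k]. Yet [4 K + 2] vertices of [A] would
     already have more neighbours than that by [card_nbhd_small], as [k] is large against [K^2]. *)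
  rewrite ltnNge; apply/negP => hA.
  have [A' A'A hA'] : exists2 A' : {set {set 'I_n}}, A' \subset A & #|A'| = 4 * K + 2.
    have /card_gt0P[B] : 0 < #|[set B : {set {set 'I_n}} | B \subset A & #|B| == 4 * K + 2]|.
      by rewrite cards_draws bin_gt0.
    by rewrite inE => /andP[hB /eqP hc]; exists B.
  have := card_nbhd_small H (subset_trans A'A AV); rewrite hA'.
  have := subset_leq_card (nbhdS H A'A); have := subset_leq_card hl; have := low_card.
  rewrite addn2 /=.
  move: t #|G| #|low| #|nbhd e A'| ht => s g l g' ht h1 h2 h3 h4.
  have h5 : g' <= 2 * (K * k) by move: (_ - _) ht h1 => s' ht h1; clear -ht h1 h2 h3; lia.
  have h6 : (4 * K).+2 * (4 * K).+1 < (4 * K + 8) ^ 2 by rewrite -mulnn; nia.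
  have h7 : (4 * K).+2 * k = 4 * (K * k) + 2 * k by rewrite mulnA -mulnDl addn2.
  by clear -h4 h5 h6 h7 hk k0; lia.
have := cov2_big v0G v0l; set V2 := cov2 v0 :\ v0 => hV2.
have hV2' := cardsID low V2.
have hlow : #|V2 :&: low| <= 2 * t.
  by apply: leq_trans low_card; apply/subset_leq_card/subsetIr.
pose W := V2 :\: low; rewrite -/W in hV2'.
have hW1 : #|W| * k <= 2 * \sum_(v in W) deg A v.
  rewrite big_distrr /= -sum_nat_const; apply: leq_sum => v.
  rewrite in_setD in_setD1 => /andP[vl /andP[_ vc]].
  by move: vl; rewrite inE (subsetP (cov2_sub _) _ vc) /= -leqNgt.
have dW v : v \in W -> dist v v0 = 2.
  rewrite in_setD in_setD1 => /andP[_ /andP[vv0 vc]].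
  by rewrite distC (cov2_dist vc vv0).
(* The vertices of [W] are at distance 2 from [v0]. A vertex of [A] at distance 1 from [v0], one of
   at most [n], is counted at most [k] times; any other has a neighbour in [W] only at distance 3,
   and then at most three of them. *)
have hW2 : \sum_(v in W) deg A v <= 3 * #|A| + n * k.
  rewrite (deg_sum H).
  pose A1 := [set u in A | dist v0 u == 1].
  rewrite (big_setID A1) /= addnC; apply: leq_add.
    apply: leq_trans (_ : 3 * #|A :\: A1| <= _); last first.
      by rewrite leq_mul2l /=; apply/subset_leq_card/subsetDl.
    rewrite mulnC -sum_nat_const; apply: leq_sum => u; rewrite in_setD inE.
    move=> /andP[hu uA]; rewrite uA /= in hu.
    have hin v : v \in nb u :&: W -> dist u v0 = 3 /\ v \in [set tog u i | i in sdiff u v0].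
      rewrite in_setI => /andP[/(nb_dist H)/dist1P[i ->]] /dW.
      rewrite dist_tog; case: ifP => hi hd; last by case/eqP: hu; rewrite distC; lia.
      by split; [lia|apply: imset_f].
    have [h0|[v /hin [d3 _]]] := set_0Vmem (nb u :&: W); first by rewrite /degree h0 cards0.
    rewrite -d3; apply: leq_trans (leq_imset_card (tog u) _).
    by apply: subset_leq_card; apply/subsetP => z /hin [].
  apply: leq_trans (_ : #|A :&: A1| * k <= _).
    by rewrite -sum_nat_const; apply: leq_sum => u _; apply: deg_le H _ _.
  rewrite leq_mul2r; apply/orP; right; apply: leq_trans (card_ball1 v0).
  by apply: subset_leq_card; apply/subsetP => u; rewrite !inE => /and3P[_ _ ->].
exfalso; clear dW.
move: #|W| #|V2 :&: low| #|V2| #|A| t (\sum_(v in W) _) hV2 hV2' hlow hW1 hW2 ht ha.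
move=> w l v2 a s sm hV2 hV2' hlow hW1 hW2 ht ha.
rewrite -mulnn in hk.
have h1 : k * w <= 12 * k * s + 4 * (k * k) by nia.
have h2 : k * (k * k) <= 2 * (k * k) + 4 * (k * w) + 8 * (k * s) by nia.
have h3 : k * s <= K * (k * k) by nia.
have h4 : k * (k * k) <= (18 + 56 * K) * (k * k) by nia.
have h5 : k <= 18 + 56 * K by rewrite -(leq_pmul2r (_ : 0 < k * k)) // muln_gt0 k0.
nia.
Qed.

End Structure.

(** * Containers *)

Lemma half_bound k psi x s : 0 < k -> 2 * psi <= k -> x * (k - psi) <= k * s -> x <= 2 * s.
Proof. by move=> k0 hk hx; rewrite -(leq_pmul2l k0); nia. Qed.

Section Containers.
Variables (n k : nat) (e : rel {set 'I_n}) (V : {set {set 'I_n}}).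
Hypothesis H : cube_graph k e V.
Variables (Y Y2 : {set {set 'I_n}}).
Implicit Types (x y z u v w : {set 'I_n}).

Local Notation nb := (nbrs e).
Local Notation deg := (degree e).

(* The fingerprint of [A] consists of [T0] in [N A], the part [R0] of [nbhd e T0]
   outside [A], [T1] in [A] and [T2] outside [N A]. *)
Definition cont_seed (T0 R0 T1 : {set {set 'I_n}}) :=
  nbhd e (nbhd e T0 :\: R0) :|: nbhd e T1.

Definition cont_out psi (T0 R0 T1 T2 : {set {set 'I_n}}) :=
  [set u in Y | #|nb u :\: cont_seed T0 R0 T1| <= psi] :\: nbhd e T2.

(** [T2] avoids [N A], so deleting its neighbourhood removes nothing of [A] from [cont_out]. It is
    chosen such that every vertex of [Y2] outside [N A] keeps at most [psi] neighbours in
    [cont_out]; exceeding [psi] therefore certifies membership in [N A]. *)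
Definition cont_in psi (T0 R0 T1 T2 : {set {set 'I_n}}) :=
  cont_seed T0 R0 T1 :|: [set v in Y2 | psi < deg (cont_out psi T0 R0 T1 T2) v].

Variable A : {set {set 'I_n}}.
Hypothesis AV : A \subset V.

Local Notation G := (nbhd e A).
Local Notation t := (#|G| - #|A|).
Local Notation cov2 := (cov2 e A).
Local Notation low := (low k e A).

(** [T0] is taken among the vertices with at most [beta] neighbours outside [A]. Uncovered are at
    most [2 t] low vertices, at most [3 t] vertices left after [j] halvings, and those whose second
    neighbours mostly lie in the exceptional set [Z], of size at most [k t / beta]. *)
Lemma seed_covers beta j : 8 <= k -> n <= 2 * k -> 0 < beta -> beta <= k -> k <= 2 ^ j ->
  #|G| <= 3 * k * t ->
  exists T0 : {set {set 'I_n}}, [/\ T0 \subset G,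
    forall v, v \in T0 -> k <= deg A v + beta,
    #|T0| <= j * (#|G| %/ (k * k %/ 16)).+1 &
    beta * #|G :\: \bigcup_(v in T0) cov2 v| <= 37 * k * t].
Proof.
move=> k8 nk b0 bk kj hg; have k0 : 0 < k by lia.
pose C := [set v in G | k <= deg A v + beta].
pose b := k * k %/ 16.
have hb : 0 < b by rewrite divn_gt0 //; nia.
have hb16 : 16 * b <= k * k by rewrite mulnC leq_divM.
pose W := [set w in G | b <= #|[set v in C | w \in cov2 v]|].
have CG : C \subset G by apply/subsetP => v; rewrite inE => /andP[].
have [w|T0 [h1 h2 h3]] := @greedy_cover _ cov2 b j C W hb.
  by rewrite inE => /andP[].
exists T0; split.
- exact: subset_trans CG.
- by move=> v /(subsetP h1); rewrite inE => /andP[].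
- apply: leq_trans h2 _; rewrite leq_mul2l ltnS leq_div2r ?orbT //.
  exact: subset_leq_card.
set cv := \bigcup_(v in T0) _ in h3 *.
have c1 : #|W :\: cv| <= 3 * t.
  have hW : #|W| <= #|G| by apply: subset_leq_card; apply/subsetP => v; rewrite inE => /andP[].
  rewrite -(leq_pmul2l k0) mulnCA mulnA; apply: leq_trans hg.
  by apply: leq_trans hW; apply: leq_trans h3; rewrite leq_mul2r kj orbT.
have c2 := low_card H k0 AV.
pose Z := G :\: C.
have cZ : #|Z| * beta <= k * t.
  apply: (low_count H AV); first exact: subsetDl.
  move=> v; rewrite in_setD => /andP[vC vG]; move: vC; rewrite inE vG /=; lia.
(* A vertex of [NT] has about [k^2 / 4] second neighbours but fewer than [k^2 / 16] in [C], hence at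
   least [k^2 / 8] in [Z]. Each vertex of [Z] serves at most [n^2] times. *)
pose NT := (G :\: low) :\: W.
have cN : #|NT| * (k * k) <= 8 * (n * n * #|Z|).
  have hs : \sum_(w in NT) #|(cov2 w :\ w) :&: Z| <= n * n * #|Z|.
    apply: (@sum_cardI_le _ (fun w => cov2 w :\ w)) => v _.
    apply: leq_trans (card_sphere2 v); apply: subset_leq_card; apply/subsetP => w.
    rewrite inE in_setD1 => /and3P[_ vw vc]; rewrite inE distC; apply/eqP.
    exact: (cov2_dist H vc vw).
  apply: leq_trans (leq_mul (leqnn 8) hs).
  rewrite big_distrr /= -sum_nat_const; apply: leq_sum => w.
  rewrite in_setD in_setD => /andP[wW /andP[wl wG]].
  move: wW; rewrite inE wG /= -ltnNge => hw.
  have := cov2_big H k0 AV wG wl.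
  have : #|cov2 w :\ w| <= #|[set v in C | w \in cov2 v]| + #|(cov2 w :\ w) :&: Z|.
    apply: leq_trans (leq_card_setU _ _).1; apply: subset_leq_card.
    apply/subsetP => v hv; have := hv; rewrite in_setD1 => /andP[vw vc].
    rewrite in_setU in_setI hv /= in_setD (subsetP (cov2_sub H A w) _ vc) andbT.
    by case: (boolP (v \in C)) => vC; rewrite ?orbT // inE vC (cov2C H) vc.
  move: #|_| #|_| #|_| hw => c x y hw h4 h5.
  have h6 : 8 * k <= k * k by rewrite leq_mul2r k8 orbT.
  lia.
have cN2 : #|NT| <= 32 * #|Z|.
  rewrite -(leq_pmul2r (_ : 0 < k * k)) ?muln_gt0 ?k0 //; apply: leq_trans cN _.
  have : n * n <= 4 * (k * k) by nia.
  by move: #|Z| (k * k) (n * n) => z x y; nia.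
have cU : #|G :\: cv| <= #|W :\: cv| + #|low| + #|NT|.
  apply: leq_trans (leq_add (leq_card_setU _ _).1 (leqnn _)).
  apply: leq_trans (leq_card_setU _ _).1; apply: subset_leq_card.
  apply/subsetP => v; rewrite !in_setU !in_setD => /andP[-> vG] /=; rewrite vG.
  by case: (v \in W); case: (v \in low).
move: #|G :\: cv| #|W :\: cv| #|low| #|NT| #|Z| t cU c1 c2 cZ cN2.
move=> x1 x2 x3 x4 z s cU c1 c2 cZ cN2.
have : beta * x1 <= beta * (5 * s + 32 * z) by rewrite leq_mul2l; apply/orP; right; lia.
have : beta * s <= k * s by rewrite leq_mul2r bk orbT.
rewrite mulnDr; nia.
Qed.

Hypothesis AY : A \subset Y.
Hypothesis YV : Y \subset V.
Hypothesis YY2 : forall x y, e x y -> x \in Y -> y \in Y2.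

Lemma container_exists psi beta j D :
  nbhd_closed e Y A -> two_linked e A ->
  8 <= k -> n <= 2 * k -> 0 < beta -> beta * beta <= k -> k <= 2 ^ j ->
  2 * psi <= k -> k <= D * psi.+1 -> k <= t -> #|A| <= 2 * k * t ->
  exists Q T0 R0 T1 T2 : {set {set 'I_n}},
  let F := cont_in psi T0 R0 T1 T2 in let S := cont_out psi T0 R0 T1 T2 in
  [/\ [/\ T0 \subset Q, R0 \subset Q, T1 \subset Q & T2 \subset Q],
      forall C : {set {set 'I_n}}, C \subset Q -> C != set0 -> C != Q ->
        exists x y, [/\ x \in C, y \in Q :\: C & dist x y <= 18],
      beta * #|Q| <= (194 * j + 39 * D + 26) * t &
      [/\ F \subset G, A \subset S, k * #|S| <= k * #|F| + 4 * psi * t,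
          #|G :\: F| <= 2 * t & #|S :\: A| <= 2 * t]].
Proof.
move=> hcl hlink k8 nk b0 bb kj psik hD kt ha.
have k0 : 0 < k by lia.
have bk : beta <= k by nia.
have hag := card_le_nbhd H AV k0.
have hg : #|G| <= 3 * k * t.
  have -> : #|G| = t + #|A| by rewrite subnK.
  by move: #|A| t ha kt => a s; nia.
have [T0 [T0G T0d T0c T0u]] := seed_covers k8 nk b0 bk kj hg.
(* Recording the few neighbours of [T0] outside [A] is enough to recover its neighbours inside
   [A]. *)
pose R0 := nbhd e T0 :\: A.
have F1E : nbhd e (nbhd e T0 :\: R0) = \bigcup_(v in T0) cov2 v.
  have -> : nbhd e T0 :\: R0 = nbhd e T0 :&: A.
    by apply/setP => u; rewrite !in_setD in_setI; case: (u \in A); case: (u \in nbhd e T0).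
  apply/setP => w; apply/(nbhdP H)/bigcupP => [[u]|[v vT0 /(cov2P H)[u [uA vu wu]]]].
    rewrite in_setI => /andP[/(nbhdP H)[v vT0 uv] uA] wu; exists v => //.
    by apply/(cov2P H); exists u; rewrite (nbC H).
  exists u => //; rewrite in_setI uA andbT; apply/(nbhdP H); exists v => //.
  by rewrite (nbC H).
set F1 := nbhd e (nbhd e T0 :\: R0) in F1E; rewrite -F1E in T0u.
have F1G : F1 \subset G by rewrite F1E; apply/bigcupsP => v _; apply: cov2_sub H A v.
(* Saturation leaves every vertex of [A] at most [psi] neighbours outside the seed. Vertices outside
   [A] with this property have most neighbours in [N A], so by [out_count] they number at most
   [2 t]. *)
have [//|T1 [T1A T1c T1s]] := @greedy_saturate _ nb psi.+1 A (G :\: F1).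
have nbU (B : {set {set 'I_n}}) : \bigcup_(x in B) nb x = nbhd e B.
  by apply/setP => z; apply/bigcupP/(nbhdP H) => -[u uB hu]; exists u.
rewrite nbU in T1s.
pose F2 := cont_seed T0 R0 T1.
have F2G : F2 \subset G by rewrite subUset F1G (nbhdS H).
have hA2 u : u \in A -> #|nb u :\: F2| <= psi.
  move=> uA; rewrite -ltnS; apply: leq_ltn_trans (T1s _ uA); apply: subset_leq_card.
  apply/subsetP => v; rewrite !in_setD !in_setI in_setD in_setU negb_or.
  move=> /andP[/andP[h1 h2] vu]; rewrite -/F1 in h1.
  by rewrite h1 h2 vu (subsetP (nb_nbhd H uA)).
pose S2 := [set u in Y | #|nb u :\: F2| <= psi].
have AS2 : A \subset S2 by apply/subsetP => u uA; rewrite inE (subsetP AY) // hA2.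
have S2deg u : u \in S2 -> k <= deg F2 u + psi.
  rewrite inE => /andP[uY hu]; rewrite -(cg_reg H (subsetP YV _ uY)).
  by rewrite -(cardsID F2 (nb u)) leq_add2l.
have degS (B B' : {set {set 'I_n}}) u : B \subset B' -> deg B u <= deg B' u.
  by move=> BB'; apply/subset_leq_card/setIS.
have cS2 : #|S2 :\: A| <= 2 * t.
  have : #|S2 :\: A| * (k - psi) <= k * t; first apply: (out_count H AV).
  - by rewrite -setI_eq0; apply/eqP/setP => u; rewrite in_setI in_setD in_set0; case: (u \in A); rewrite ?andbF.
  - apply: subset_trans (subsetDl _ _) _; apply: subset_trans YV.
    by apply/subsetP => u; rewrite inE => /andP[].
  - move=> u; rewrite in_setD => /andP[_ /S2deg hu].
    by rewrite leq_subLR addnC; apply: leq_trans hu _; rewrite leq_add2r degS.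
  move=> hx; exact: half_bound k0 psik hx.
(* Any such vertex proves that its neighbours are outside [A]. The saturating set [T2] discards
   enough of [S2] for each of them to see at most [psi] of what remains. *)
pose C2 := [set v in Y2 | (v \notin G) && [exists u in S2, u \in nb v]].
have [//|T2 [T2C T2c T2s]] := @greedy_saturate _ nb psi.+1 C2 (S2 :\: A).
rewrite nbU in T2s.
pose S := cont_out psi T0 R0 T1 T2; pose F := cont_in psi T0 R0 T1 T2.
have SE : S = S2 :\: nbhd e T2 by [].
have AS : A \subset S.
  apply/subsetP => u uA; rewrite SE in_setD (subsetP AS2) // andbT.
  apply/negP => /(nbhdP H)[v vT2]; rewrite (nbC H) => hu.
  have := subsetP T2C _ vT2; rewrite inE => /and3P[_ vG _].
  by rewrite (subsetP (nb_nbhd H uA)) in vG.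
have hS v : v \in Y2 -> v \notin G -> deg S v <= psi.
  move=> vY2 vG.
  have [hv|hv] := boolP [exists u in S2, u \in nb v]; last first.
    rewrite /degree (_ : nb v :&: S = set0) ?cards0 //; apply/setP => u.
    rewrite in_setI in_set0 SE in_setD; apply: contraNF hv => /and3P[h1 _ h2].
    by apply/exists_inP; exists u.
  have vC : v \in C2 by rewrite inE vY2 vG.
  rewrite -ltnS; apply: leq_ltn_trans (T2s _ vC); apply: subset_leq_card.
  apply/subsetP => u; rewrite in_setI SE in_setD => /and3P[uv h1 h2].
  rewrite in_setD h1 in_setI uv in_setD h2 andbT /=; apply: contra vG => uA.
  by apply: (subsetP (nb_nbhd H uA)); rewrite (nbC H).
have FG : F \subset G.
  rewrite subUset F2G; apply/subsetP => v; rewrite inE => /andP[vY2 hv].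
  by apply: contraLR hv => vG; rewrite -leqNgt hS.
have SS2 : S \subset S2 by rewrite SE subsetDl.
have cS : #|S :\: A| <= 2 * t by apply: leq_trans cS2; apply/subset_leq_card/setSD.
have GY2 : G \subset Y2.
  apply/subsetP => v /(nbhdP H)[u uA]; rewrite inE => /YY2; apply; exact: (subsetP AY).
have notF v : v \in G :\: F -> deg S v <= psi.
  rewrite in_setD in_setU negb_or => /andP[/andP[_ h] vG].
  by move: h; rewrite inE (subsetP GY2) //= -leqNgt.
have cG : #|G :\: F| <= 2 * t.
  have := @low_count _ _ _ _ H A AV (k - psi) (G :\: F) (subsetDl _ _).
  move=> h; have {h} : #|G :\: F| * (k - psi) <= k * t.
    apply: h => v /notF h; have h' := leq_trans (degS A S v AS) h.
    by clear -h' psik; lia.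
  move=> hx; exact: half_bound k0 psik hx.
(* Of the [k |S|] edges at [S], at most [k |F|] end in [F]. The others start in [A] and end in
   [N A :\: F], or start in [S :\: A]; either set has size at most [2 t], with at most [psi] such
   edges per vertex. *)
have hSF : k * #|S| <= k * #|F| + 4 * psi * t.
  have SY : S \subset V.
    apply: subset_trans SS2 _; apply: subset_trans YV.
    by apply/subsetP => u; rewrite inE => /andP[].
  have E1 : k * #|S| = \sum_(u in S) deg F u + \sum_(u in S) #|nb u :\: F|.
    rewrite -big_split /= mulnC -sum_nat_const; apply: eq_bigr => u uS.
    by rewrite cardsID (cg_reg H) // (subsetP SY).
  have E2 : \sum_(u in S) deg F u <= k * #|F|.
    rewrite (deg_sum H) mulnC -sum_nat_const; apply: leq_sum => v _; exact: deg_le H _ _.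
  have E3 : \sum_(u in S) #|nb u :\: F| <= psi * #|G :\: F| + psi * #|S :\: A|.
    rewrite (big_setID A) /= (setIidPr AS); apply: leq_add.
      have -> : \sum_(u in A) #|nb u :\: F| = \sum_(u in A) deg (G :\: F) u.
        apply: eq_bigr => u uA; rewrite /degree; congr #|pred_of_set _|.
        apply/setP => v; rewrite in_setI !in_setD.
        case: (boolP (v \in nb u)) => vu; rewrite ?andbF //=.
        by rewrite (subsetP (nb_nbhd H uA)).
      rewrite (deg_sum H) mulnC -sum_nat_const; apply: leq_sum => v /notF.
      exact: leq_trans (degS _ _ _ AS).
    rewrite mulnC -sum_nat_const; apply: leq_sum => u; rewrite in_setD => /andP[_ uS].
    have := subsetP SS2 _ uS; rewrite inE => /andP[_]; apply: leq_trans.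
    by apply/subset_leq_card/setDS/subsetUl.
  have h1 := leq_mul (leqnn psi) cG; have h2 := leq_mul (leqnn psi) cS.
  by clear -E1 E2 E3 h1 h2; lia.
have k4 : 4 <= k by apply: leq_trans k8.
have [Qn [QnG Qnet Qnc]] := net_exists H k0 AV k4 hg.
(* The net makes the fingerprint linked: its other parts are within distance 2 of [N A], hence
   [net_linked] applies with radius 8 and gives [2 * 8 + 2 = 18]. *)
pose Q := Qn :|: (T0 :|: (R0 :|: (T1 :|: T2))).
have T0Q : T0 \subset Q by apply/subsetP => x hx; rewrite !in_setU hx !orbT.
have R0Q : R0 \subset Q by apply/subsetP => x hx; rewrite !in_setU hx !orbT.
have T1Q : T1 \subset Q by apply/subsetP => x hx; rewrite !in_setU hx !orbT.
have T2Q : T2 \subset Q by apply/subsetP => x hx; rewrite !in_setU hx !orbT.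
exists Q, T0, R0, T1, T2; split => //.
  apply: (@net_linked _ _ _ _ H A 8 Q hlink).
    move=> v /Qnet [q qQ hq]; exists q => //.
    by rewrite in_setU qQ.
  move=> q; rewrite !in_setU => /or4P[hq|hq|hq|hq].
  - by exists q; rewrite ?distxx // (subsetP QnG).
  - by exists q; rewrite ?distxx // (subsetP T0G).
  - move: hq; rewrite in_setD => /andP[_ /(nbhdP H)[v vT0 hv]].
    by exists v; rewrite ?(nb_dist H hv) // (subsetP T0G).
  - case/orP: hq => hq.
      have qA := subsetP T1A _ hq.
      have [v hv] := nb_neq0 H k0 (subsetP AV _ qA).
      exists v; first exact: (subsetP (nb_nbhd H qA)).
      by rewrite distC (nb_dist H hv).
    have := subsetP T2C _ hq; rewrite inE => /and3P[_ _ /exists_inP[u uS2 uq]].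
    have : 0 < deg F2 u by have h := S2deg _ uS2; clear -h psik k0; lia.
    case/card_gt0P => v; rewrite in_setI => /andP[vu vF2].
    exists v; first exact: (subsetP F2G).
    have := dist_triangle u v q; rewrite (distC v u) (distC u q).
    by rewrite (nb_dist H vu) (nb_dist H uq) => h; apply: leq_trans h _.
have cR0 : #|R0| <= beta * #|T0|.
  have -> : R0 = \bigcup_(v in T0) (nb v :\: A).
    apply/setP => u; rewrite in_setD; apply/andP/bigcupP.
      by case=> uA /(nbhdP H)[v vT uv]; exists v => //; rewrite in_setD uA.
    case=> v vT; rewrite in_setD => /andP[-> uv]; split=> //.
    by apply/(nbhdP H); exists v.
  apply: leq_trans (card_bigcup_le _ _) _; rewrite mulnC -sum_nat_const.
  apply: leq_sum => v vT; have h1 := T0d _ vT.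
  have h2 := cardsID A (nb v).
  rewrite (cg_reg H (subsetP (nbhd_sub H A) _ (subsetP T0G _ vT))) in h2.
  by rewrite -{1}h2 leq_add2l in h1.
have cQ : #|Q| <= #|Qn| + (#|T0| + (#|R0| + (#|T1| + #|T2|))).
  do 4 (apply: leq_trans (leq_card_setU _ _).1 _; rewrite ?leq_add2l //).
have cT0 : k * #|T0| <= 97 * j * t.
  have hq : #|G| %/ (k * k %/ 16) * k <= 96 * t.
    set b := k * k %/ 16.
    have hb : k * k < 16 * b.+1 by rewrite mulnC ltn_ceil.
    have hbb : k * k <= 32 * b by clear -hb k8; nia.
    have := leq_divM #|G| b; move: (#|G| %/ b) t hg => q s hg hq.
    move: #|G| hg hq => g hg hq; clear -hg hq hbb k0.
    have hqk : q * (k * k) <= 32 * g.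
      apply: leq_trans (leq_mul (leqnn q) hbb) _.
      by rewrite mulnCA leq_mul2l hq.
    by rewrite -(leq_pmul2r k0); nia.
  have := leq_mul (leqnn k) T0c; move: (_ %/ _) hq => q hq.
  move: #|T0| t hq kt => x s hq kt hx.
  apply: leq_trans hx _; rewrite mulnCA -mulnA [97 * _]mulnC -mulnA leq_mul2l; apply/orP; right.
  by rewrite mulnS mulnC; clear -hq kt; lia.
have cT1 : beta * #|T1| <= 37 * D * t.
  rewrite -(leq_pmul2r (ltn0Sn psi)) -mulnA.
  apply: leq_trans (leq_mul (leqnn beta) T1c) _; apply: leq_trans T0u _.
  by move: t => s; rewrite -!mulnA leq_mul2l /= [s * _]mulnC mulnA leq_mul2r hD orbT.
have cT2 : beta * #|T2| <= 2 * D * t.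
  rewrite -(leq_pmul2r (ltn0Sn psi)) -mulnA.
  apply: leq_trans (leq_mul bk (leq_trans T2c cS2)) _.
  by move: t => s; rewrite mulnCA -!mulnA leq_mul2l /= [s * _]mulnC mulnA leq_mul2r hD orbT.
have cQn : beta * #|Qn| <= 26 * t.
  by apply: leq_trans Qnc; rewrite mulnC leq_mul2l bk orbT.
(* Here [beta * beta <= k] enters: [R0] may be [beta] times as large as [T0], and the estimate loses
   a further factor [beta]. *)
have cTR : beta * (#|T0| + #|R0|) <= 194 * j * t.
  have h1 : beta * (#|T0| + #|R0|) <= 2 * (k * #|T0|).
    move: #|T0| #|R0| cR0 => x y hy.
    have : beta * y <= beta * beta * x by rewrite -mulnA leq_mul2l hy orbT.
    have : beta * beta * x <= k * x by rewrite leq_mul2r bb orbT.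
    have : beta * x <= k * x by rewrite leq_mul2r bk orbT.
    by rewrite mulnDr; clear; lia.
  apply: leq_trans h1 _; move: cT0; rewrite -!mulnA; clear; lia.
apply: leq_trans (leq_mul (leqnn beta) cQ) _.
rewrite !mulnDl.
move: (leq_add (leq_add (leq_add cTR cQn) cT1) cT2).
by rewrite !mulnDr -!mulnA; clear; lia.
Qed.

End Containers.

(** * Maximal matchings and the decoding of closed sets *)

Section Matching.
Variables (T : finType) (e : rel T).
Implicit Types (F S A D E X Z : {set T}) (M : {set T * T}).

Definition is_matching F S M :=
  [forall m in M, [&& m.1 \in S, m.2 \notin F & e m.1 m.2]] &&
  [forall m in M, forall m' in M, (m.1 == m'.1) || (m.2 == m'.2) ==> (m == m')].

(** Any maximal matching would serve; a fixed choice makes it a function of the pair [(F, S)], so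
    that it adds nothing to the union bound. *)
Definition matching F S : {set T * T} :=
  odflt set0 [pick M | maxset (is_matching F S) M].
Definition msrc F S := [set m.1 | m in matching F S].
Definition mtgt F S := [set m.2 | m in matching F S].

Lemma matching_maxset F S : maxset (is_matching F S) (matching F S).
Proof.
rewrite /matching; case: pickP => //= h.
have h0 : is_matching F S set0.
  by apply/andP; split; apply/forall_inP => m; rewrite inE.
by have [M hM _] := maxset_exists h0; rewrite h in hM.
Qed.

Lemma matchingP F S m : m \in matching F S ->
  [/\ m.1 \in S, m.2 \notin F & e m.1 m.2].
Proof.
have /maxsetp/andP[/forall_inP h _] := matching_maxset F S.
by move/h/and3P.
Qed.

Lemma matching_inj F S m m' : m \in matching F S -> m' \in matching F S ->
  (m.1 == m'.1) || (m.2 == m'.2) -> m = m'.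
Proof.
have /maxsetp/andP[_ /forall_inP h] := matching_maxset F S.
by move=> /h/forall_inP h1 /h1 /implyP h2 /h2 /eqP.
Qed.

Lemma matching_maximal F S u v : u \in S -> v \notin F -> e u v ->
  (u \in msrc F S) || (v \in mtgt F S).
Proof.
move=> uS vF uv; apply: contraT; rewrite negb_or => /andP[hu hv].
have /maxsetP[/andP[/forall_inP h1 _] hmax] := matching_maxset F S.
set M := matching F S in h1 hmax hu hv *.
have nM : (u, v) \notin M by apply: contra hu => hM; apply/imsetP; exists (u, v).
suff hM : (u, v) |: M = M by rewrite -hM setU11 in nM.
have fresh m : m \in M -> (m.1 == u) || (m.2 == v) = false.
  move=> hm; apply/negP => /orP[/eqP h|/eqP h].
    by case/negP: hu; apply/imsetP; exists m.
  by case/negP: hv; apply/imsetP; exists m.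
apply: hmax; last exact: subsetUr.
apply/andP; split; apply/forall_inP => m; rewrite in_setU1 => /orP[/eqP ->|hm] /=.
- by rewrite uS vF uv.
- exact: h1.
- apply/forall_inP => m'; rewrite in_setU1 => /orP[/eqP ->|hm']; first by rewrite eqxx implybT.
  by rewrite /= eq_sym [v == _]eq_sym fresh.
- apply/forall_inP => m'; rewrite in_setU1 => /orP[/eqP ->|hm']; first by rewrite /= fresh.
  by apply/implyP => /(matching_inj hm hm') ->.
Qed.

Lemma card_msrc F S : #|msrc F S| = #|matching F S|.
Proof.
apply: card_in_imset => m m' hm hm' h.
by apply: (matching_inj hm hm'); rewrite h eqxx.
Qed.

Lemma card_mtgt F S : #|mtgt F S| = #|matching F S|.
Proof.
apply: card_in_imset => m m' hm hm' h.
by apply: (matching_inj hm hm'); rewrite h eqxx orbT.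
Qed.

Lemma msrc_sub F S : msrc F S \subset S.
Proof. by apply/subsetP => u /imsetP[m /matchingP[h _ _] ->]. Qed.

Lemma cardI_sum (I : finType) (M : {set I}) (f : I -> T) B : {in M &, injective f} ->
  #|(f @: M) :&: B| = \sum_(m in M) (f m \in B : nat).
Proof.
move=> hf; rewrite -sum1_card (eq_bigl (fun x => (x \in f @: M) && (x \in B))); last first.
  by move=> x; rewrite in_setI.
rewrite big_mkcondr /= big_imset //=.
Qed.

(** Every matching edge has an end in [D] or in [E]. If both ends are in [X], that end is counted on
    the right; otherwise the edge contributes at most one on the left. *)
Lemma matching_cover F S D E X :
  (forall u v, u \in S -> v \notin F -> e u v -> (u \in D) || (v \in E)) ->
  #|msrc F S :&: X| + #|mtgt F S :&: X| <= #|matching F S| + #|D :&: X| + #|E :&: X|.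
Proof.
move=> hDE.
have i1 : {in matching F S &, injective fst}.
  by move=> m m' hm hm' h; apply: (matching_inj hm hm'); rewrite h eqxx.
have i2 : {in matching F S &, injective snd}.
  by move=> m m' hm hm' h; apply: (matching_inj hm hm'); rewrite h eqxx orbT.
have h1 : #|msrc F S :&: (D :&: X)| <= #|D :&: X| by apply/subset_leq_card/subsetIr.
have h2 : #|mtgt F S :&: (E :&: X)| <= #|E :&: X| by apply/subset_leq_card/subsetIr.
rewrite -addnA; apply: leq_trans (leq_add (leqnn _) (leq_add h1 h2)).
rewrite !cardI_sum // -sum1_card -!big_split /=; apply: leq_sum => m hm.
have [hS hF he] := matchingP hm; have := hDE _ _ hS hF he.
by rewrite !in_setI; case: (m.1 \in D); case: (m.2 \in E); case: (m.1 \in X); case: (m.2 \in X).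
Qed.

Lemma matching_card F S D E :
  (forall u v, u \in S -> v \notin F -> e u v -> (u \in D) || (v \in E)) ->
  #|matching F S| <= #|D| + #|E|.
Proof.
move=> h; have := matching_cover setT h; rewrite !setIT card_msrc card_mtgt; lia.
Qed.

Lemma balance F (G : {set T}) A S X : F \subset G -> A \subset S ->
  #|G :&: X| + #|S :&: X| = #|A :&: X| + #|F :&: X| + #|(S :\: A) :&: X| + #|(G :\: F) :&: X|.
Proof.
have E (B C : {set T}) : B \subset C -> #|C :&: X| = #|B :&: X| + #|(C :\: B) :&: X|.
  move=> BC; rewrite -(cardsID B (C :&: X)) setIAC (setIidPr BC); congr addn.
  by rewrite setIDAC.
by move=> /E -> /E ->; lia.
Qed.

(* By maximality of the matching, the neighbours outside [F] of a vertex of [S]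
   that is not matched all lie in [mtgt F S]. *)
Definition cover_decode F S (Z1 Z2 : {set T}) : {set T} :=
  [set u in S | if u \in msrc F S then u \notin Z1
                else [forall v, e u v ==> (v \notin F) ==> (v \in Z2)]].

(** The witnesses are the matched vertices outside [A] and the matched targets in [N A]. If all
    neighbours outside [F] of an unmatched [u] are such targets, adding [u] to [A] leaves [N A]
    unchanged, so [u] is in [A] as [A] is closed. *)
Lemma decode_closed Y F A S : (symmetric e) ->
  nbhd_closed e Y A -> A \subset S -> F \subset nbhd e A -> S \subset Y -> A \subset Y ->
  exists Z1 Z2, [/\ Z1 \subset msrc F S, Z2 \subset mtgt F S & cover_decode F S Z1 Z2 = A].
Proof.
move=> es hcl AS FG SY AY; exists (msrc F S :\: A), (mtgt F S :&: nbhd e A).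
split; [exact: subsetDl|exact: subsetIl|].
apply/setP => u; rewrite !inE.
have [uS|uS] := boolP (u \in S); last by apply/esym; apply: contraNF uS; apply/subsetP.
case: ifP => hu; first by rewrite hu andbT negbK.
apply/forallP/idP => [h|uA v]; last first.
  apply/implyP => uv; apply/implyP => vF.
  have := matching_maximal uS vF uv; rewrite hu /= => hv.
  by rewrite in_setI hv inE; apply/exists_inP; exists u.
apply: contraT => unA; case/negP: hcl; apply/existsP; exists (u |: A); apply/and3P; split.
- by rewrite subUset AY sub1set (subsetP SY).
- by apply/properP; split; [exact: subsetUr|exists u => //; exact: setU11].
- rewrite eqEsubset; apply/andP; split; apply/subsetP => v; rewrite !inE; last first.
    by case/exists_inP => w wA wv; apply/exists_inP; exists w; rewrite // in_setU1 wA orbT.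
  case/exists_inP => w; rewrite in_setU1 => /orP[/eqP ->|wA] wv; last first.
    by apply/exists_inP; exists w.
  have [vF|vF] := boolP (v \in F); first by have := subsetP FG _ vF; rewrite inE.
  by have /implyP/(_ wv)/implyP/(_ vF) := h v; rewrite in_setI inE => /andP[].
Qed.

End Matching.

(** * The middle layers *)

Section MiddleLayers.
Variable k : nat.
Hypothesis k0 : 0 < k.
Local Notation n := (2 * k - 1).
Implicit Types (x y : {set 'I_n}).

Lemma adj_sym : symmetric (adj k).
Proof. by move=> x y; rewrite /adj orbC. Qed.

Lemma sdiff_subset x y : y \subset x -> sdiff x y = x :\: y.
Proof.
move/subsetP => h; apply/setP => i; rewrite !inE.
by have := h i; case: (i \in x); case: (i \in y) => // /(_ isT).
Qed.

Lemma adj_dist x y : adj k x y -> dist x y = 1.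
Proof.
wlog hx : x y / (x \in upper k) && (y \in lower k) && (y \subset x).
  move=> h hxy; case/orP: (hxy) => /and3P[h1 h2 h3].
    by apply: h; rewrite // h1 h2.
  by rewrite distC; apply: h; rewrite ?h1 ?h2 // adj_sym.
case/andP: hx => /andP[]; rewrite !inE => /eqP hx /eqP hy yx _.
by rewrite /dist sdiff_subset // cardsD (setIidPr yx) hx hy; lia.
Qed.

Lemma upper_lower_disjoint x : x \in upper k -> x \in lower k -> False.
Proof. by rewrite !inE => /eqP -> /eqP; lia. Qed.

Lemma adj_upper x y : adj k x y -> x \in upper k -> y \in lower k.
Proof. by case/orP => /and3P[h1 h2 _] // /upper_lower_disjoint /(_ h2). Qed.

Lemma adj_lower x y : adj k x y -> x \in lower k -> y \in upper k.
Proof. by case/orP => /and3P[h1 h2 _] // /(upper_lower_disjoint h1). Qed.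

Lemma adj_reg x : x \in vertices k -> #|nbrs (adj k) x| = k.
Proof.
rewrite inE => /orP[hx|hx].
  have cx : #|x| = k by move: hx; rewrite inE => /eqP.
  have inj : {in x &, injective (fun i => x :\ i)}.
    move=> i j ix jx h; have := setD11 i x; rewrite h in_setD1 ix andbT.
    by move/negbFE/eqP.
  rewrite -[RHS]cx -(card_in_imset inj); congr #|pred_of_set _|.
  apply/setP => y; rewrite inE; apply/idP/imsetP => [h|[i ix ->]].
    have hy := adj_upper h hx; have /dist1P[i hi] := adj_dist h.
    case/orP: h => /and3P[h1 h2 h3]; last by case: (upper_lower_disjoint h1 hy).
    move: h2; rewrite inE => /eqP cy.
    have ix : i \in x.
      apply: contraT => ix; have : x \subset y.
        by rewrite hi; apply/subsetP => j jx; rewrite !inE jx; apply: contraNneq ix => <-.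
      by move/subset_leq_card; rewrite cx cy; lia.
    exists i => //; rewrite hi; apply/setP => j; rewrite !inE.
    by case: eqP => [->|_] /=; rewrite ?ix // addbF.
  rewrite /adj hx subsetDl /= !andbT inE; apply/orP; left.
  by have := cardsD1 i x; rewrite ix cx; lia.
have cx : #|x| = k.-1 by move: hx; rewrite inE => /eqP.
have inj : {in ~: x &, injective (fun i => i |: x)}.
  move=> i j; rewrite !inE => ix jx h; have := setU11 i x; rewrite h in_setU1.
  by rewrite (negbTE ix) orbF => /eqP.
have hk : k = #|~: x| by rewrite cardsCs setCK card_ord cx; lia.
rewrite [RHS]hk -(card_in_imset inj); congr #|pred_of_set _|.
apply/setP => y; rewrite inE; apply/idP/imsetP => [h|[i ix ->]].
  have hy := adj_lower h hx; have /dist1P[i hi] := adj_dist h.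
  have cy : #|y| = k by move: hy; rewrite inE => /eqP.
  have ix : i \notin x.
    apply/negP => ix; have : y \subset x.
      rewrite hi; apply/subsetP => j; rewrite !inE.
      by case: eqP => [->|_]; rewrite ?ix ?addbF.
    by move/subset_leq_card; rewrite cx cy; lia.
  exists i; rewrite ?inE // hi; apply/setP => j; rewrite !inE.
  by case: eqP => [->|_] /=; rewrite ?(negbTE ix) // addbF.
rewrite /adj hx subsetUr /=; apply/orP; right.
rewrite !andbT inE cardsU1; rewrite inE in ix; rewrite ix cx; lia.
Qed.

Lemma middle_cube_graph : cube_graph k (adj k) (vertices k).
Proof.
split; [exact: adj_sym|exact: adj_dist| |exact: adj_reg].
by move=> x y /orP[]/and3P[h1 h2 _]; rewrite inE ?h1 ?h2 ?orbT.
Qed.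

End MiddleLayers.

(** * Smoothing *)

Local Open Scope ring_scope.

Definition fluct (R : realFieldType) (T : finType) (V : {set T}) (p : R)
  (w : T -> R) (X : {set T}) : R := \sum_(x in V) w x * ((x \in X)%:R - p).

Section Averaging.
Variables (R : realFieldType) (n k : nat) (e : rel {set 'I_n}) (V : {set {set 'I_n}}).
Hypothesis H : cube_graph k e V.
Hypothesis k0 : (0 < k)%N.
Implicit Types (x y : {set 'I_n}) (f g h : {set 'I_n} -> R).

Definition average h x : R := k%:R^-1 * \sum_(y in nbrs e x) h y.
Definition norm1 h : R := \sum_x `|h x|.
Definition indf (A : {set {set 'I_n}}) x : R := (x \in A)%:R.
Definition bdry (A : {set {set 'I_n}}) x : R := indf (nbhd e A) x - indf A x.

Let kR : 0 < k%:R :> R.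
Proof. by rewrite ltr0n. Qed.

Lemma eq_avg f g : f =1 g -> average f =1 average g.
Proof. by move=> fg x; congr (_ * _); apply: eq_bigr. Qed.

Lemma eq_norm1 f g : f =1 g -> norm1 f = norm1 g.
Proof. by move=> fg; apply: eq_bigr => x _; rewrite fg. Qed.

Lemma avgD f g x : average (fun y => f y + g y) x = average f x + average g x.
Proof. by rewrite /average big_split mulrDr. Qed.

Lemma avgN f x : average (fun y => - f y) x = - average f x.
Proof. by rewrite /average sumrN mulrN. Qed.

Lemma norm1D f g : norm1 (fun x => f x + g x) <= norm1 f + norm1 g.
Proof. by rewrite /norm1 -big_split; apply: ler_sum => x _; apply: ler_normD. Qed.

Lemma norm1N f : norm1 (fun x => - f x) = norm1 f.
Proof. by apply: eq_bigr => x _; rewrite normrN. Qed.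

Lemma sum_nb_exchange (a : {set 'I_n} -> {set 'I_n} -> R) :
  \sum_x \sum_(y in nbrs e x) a x y = \sum_y \sum_(x in nbrs e y) a x y.
Proof.
rewrite (exchange_big_dep predT) //=; apply: eq_bigr => y _.
by apply: eq_bigl => x; rewrite (nbC H).
Qed.

Lemma avg_sym f g : \sum_x f x * average g x = \sum_x average f x * g x.
Proof.
have E f' g' : \sum_x f' x * average g' x = k%:R^-1 * \sum_x \sum_(y in nbrs e x) f' x * g' y.
  by rewrite mulr_sumr; apply: eq_bigr => x _; rewrite /average mulrCA mulr_sumr.
have -> : \sum_x average f x * g x = \sum_x g x * average f x.
  by apply: eq_bigr => x _; rewrite mulrC.
rewrite !E sum_nb_exchange.
by congr (_ * _); apply: eq_bigr => x _; apply: eq_bigr => y _; rewrite mulrC.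
Qed.

Lemma card_nb_le x : (#|nbrs e x| <= k)%N.
Proof. by have := deg_le H setT x; rewrite /degree setIT. Qed.

Lemma avg_norm1 f : norm1 (average f) <= norm1 f.
Proof.
apply: le_trans (_ : \sum_x k%:R^-1 * \sum_(y in nbrs e x) `|f y| <= _).
  apply: ler_sum => x _; rewrite normrM gtr0_norm ?invr_gt0 //.
  by rewrite ler_wpM2l ?invr_ge0 ?ler0n //; apply: ler_norm_sum.
rewrite -mulr_sumr sum_nb_exchange mulr_sumr; apply: ler_sum => y _.
rewrite sumr_const -[X in _ * X]mulr_natl mulrA ler_piMl //.
by rewrite mulrC ler_pdivrMr // mul1r ler_nat card_nb_le.
Qed.

Lemma sum_avg_ind (A : {set {set 'I_n}}) : A \subset V ->
  \sum_x average (indf A) x = #|A|%:R.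
Proof.
move=> AV; rewrite /average -mulr_sumr sum_nb_exchange.
have -> : \sum_y \sum_(x in nbrs e y) indf A y = \sum_(y in A) k%:R.
  rewrite [RHS]big_mkcond /=; apply: eq_bigr => y _; rewrite sumr_const /indf.
  case: ifP => yA; last by rewrite mul0rn.
  by rewrite (cg_reg H) // (subsetP AV).
by rewrite sumr_const mulrnAr mulVf // gt_eqF.
Qed.

Lemma avg_indE (A : {set {set 'I_n}}) x : average (indf A) x = (degree e A x)%:R / k%:R.
Proof.
rewrite /average mulrC; congr (_ / _); rewrite /degree -sum1_card natr_sum.
rewrite [LHS]big_mkcond [RHS]big_mkcond /=; apply: eq_bigr => y _; rewrite in_setI /indf.
by case: (y \in nbrs e x); case: (y \in A).
Qed.

Lemma sum_ind (A : {set {set 'I_n}}) : \sum_x indf A x = #|A|%:R.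
Proof.
rewrite -sum1_card natr_sum [RHS]big_mkcond /=.
by apply: eq_bigr => x _; rewrite /indf; case: ifP.
Qed.

(** With [P] the averaging operator, [h + P h] is the sum of [1_G - P 1_A] and [P 1_G - 1_A]. Both
    are nonnegative, and as [P] preserves the mass of indicators, each has total mass
    [|G| - |A|]. *)
Lemma bdry_norm1 (A : {set {set 'I_n}}) : A \subset V ->
  norm1 (fun x => bdry A x + average (bdry A) x) <= 2 * (#|nbhd e A|%:R - #|A|%:R).
Proof.
move=> AV; set h := bdry A; set G := nbhd e A.
have hE x : h x + average h x = (indf G x - average (indf A) x) + (average (indf G) x - indf A x).
  by rewrite /h /bdry -/G (avgD (indf G) (fun y => - indf A y)) avgN; ring.
rewrite (eq_norm1 hE); apply: le_trans (norm1D _ _) _.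
have n1 : norm1 (fun x => indf G x - average (indf A) x) = #|G|%:R - #|A|%:R.
  rewrite -(sum_avg_ind AV) -(sum_ind G) -sumrB; apply: eq_bigr => x _.
  rewrite ger0_norm // subr_ge0 avg_indE /indf.
  have [xG|xG] := boolP (x \in G); first by rewrite ler_pdivrMr // mul1r ler_nat (deg_le H).
  by move: xG; rewrite -(deg_gt0 H) -eqn0Ngt => /eqP ->; rewrite mul0r.
have n2 : norm1 (fun x => average (indf G) x - indf A x) = #|G|%:R - #|A|%:R.
  rewrite -(sum_avg_ind (nbhd_sub H A)) -(sum_ind A) -sumrB; apply: eq_bigr => x _.
  rewrite ger0_norm // subr_ge0 avg_indE /indf.
  have [xA|xA] := boolP (x \in A); last by rewrite divr_ge0 ?ler0n.
  by rewrite (deg_full H) ?(subsetP AV) ?(nb_nbhd H) // divff // gt_eqF.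
by rewrite n1 n2 mulr2n mulrDl !mul1r.
Qed.

(** The power is even so that [1 + P] divides [1 - P^4], and four steps bring the squared l2 norm of
    the kernel down to O(k^-4). *)
Definition avg4 h := iter 4 average h.

Lemma avg4_norm1 h : norm1 (avg4 h) <= norm1 h.
Proof. by do 4 (apply: le_trans (avg_norm1 _) _). Qed.

Lemma smooth_le h : norm1 (fun x => h x - avg4 h x) <= 2 * norm1 h.
Proof.
apply: le_trans (norm1D h (fun x => - avg4 h x)) _.
by rewrite norm1N mulr2n mulrDl !mul1r lerD2l avg4_norm1.
Qed.

(** [1 - P^4 = (1 - P + P^2 - P^3) (1 + P)], and [P] contracts the l1 norm. *)
Lemma smooth_bdry h : norm1 (fun x => h x - avg4 h x) <= 4 * norm1 (fun x => h x + average h x).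
Proof.
pose r x := h x + average h x.
have r1 x : average r x = average h x + average (average h) x by rewrite /r avgD.
have r2 x : average (average r) x = average (average h) x + average (average (average h)) x.
  by rewrite (eq_avg r1) avgD.
have r3 x : average (average (average r)) x = average (average (average h)) x + avg4 h x.
  by rewrite (eq_avg r2) avgD.
have E x : h x - avg4 h x = (r x + - average r x) + (average (average r) x + - average (average (average r)) x).
  by rewrite r1 r2 r3 /r; ring.
have b1 := avg_norm1 r; have b2 := avg_norm1 (average r); have b3 := avg_norm1 (average (average r)).
rewrite (eq_norm1 E); apply: le_trans (norm1D _ _) _.
have c1 := norm1D r (fun x => - average r x).
have c2 := norm1D (average (average r)) (fun x => - average (average (average r)) x).
rewrite !norm1N in c1 c2; rewrite -/r; lra.
Qed.

(* Dominates [iter m average (delta x)] at distance [d] from [x]: of the cube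
   neighbours of such a point, [d] are at distance [d - 1] and at most [n] at
   distance [d + 1]. *)
Fixpoint radial m d : R :=
  if m is m'.+1 then k%:R^-1 * (d%:R * radial m' d.-1 + n%:R * radial m' d.+1)
  else (d == 0)%:R.

Lemma radial_ge0 m d : 0 <= radial m d.
Proof.
elim: m d => //= m IH d.
by rewrite mulr_ge0 ?invr_ge0 ?ler0n // addr_ge0 // mulr_ge0.
Qed.

Definition delta x y : R := (x == y)%:R.

Lemma avg_radial m x y : 0 <= iter m average (delta x) y <= radial m (dist y x).
Proof.
elim: m y => [|m IH] y /=; first by rewrite ler0n /delta dist0 eq_sym lexx.
set h := iter m average (delta x) in IH *.
have h0 z : 0 <= h z by case/andP: (IH z).
apply/andP; split; first by rewrite mulr_ge0 ?invr_ge0 ?ler0n // sumr_ge0.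
rewrite ler_wpM2l ?invr_ge0 ?ler0n //.
apply: le_trans (_ : \sum_i h (tog y i) <= _).
  have -> : \sum_i h (tog y i) = \sum_(z in [set tog y i | i in 'I_n]) h z.
    by rewrite big_imset //= => i j _ _; apply: tog_inj.
  rewrite [leRHS](bigID (mem (nbrs e y))) /= -[leLHS]addr0 lerD ?sumr_ge0 //.
  rewrite [leLHS]big_mkcond [leRHS]big_mkcond /=; apply: ler_sum => z _.
  have [zy|_] := boolP (z \in nbrs e y); last by rewrite andbF.
  have /dist1P[i ->] := nb_dist H zy; rewrite andbT.
  by rewrite imset_f.
rewrite (bigID (mem (sdiff y x))) /=; apply: lerD.
  apply: le_trans (_ : \sum_(i in sdiff y x) radial m (dist y x).-1 <= _).
    apply: ler_sum => i hi; have /andP[_] := IH (tog y i).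
    by rewrite dist_tog hi.
  by rewrite sumr_const mulr_natl.
apply: le_trans (_ : \sum_(i | i \notin sdiff y x) radial m (dist y x).+1 <= _).
  apply: ler_sum => i hi; have /andP[_] := IH (tog y i).
  by rewrite dist_tog (negbTE hi).
rewrite sumr_const -[leLHS]mulr_natl ler_wpM2r ?radial_ge0 // ler_nat.
by rewrite -[X in (_ <= X)%N]card_ord max_card.
Qed.

(** [105 = 7 * 5 * 3] is the number of ways to pair the eight flips of a closed walk; every pair
    brings a factor [n]. *)
Lemma radial80 : radial 8 0 = 105 * n%:R ^+ 4 / k%:R ^+ 8.
Proof. rewrite /=; field; by rewrite gt_eqF. Qed.

Lemma iter_avg_sym m f g : \sum_x f x * iter m average g x = \sum_x iter m average f x * g x.
Proof.
elim: m f g => [//|m IH] f g.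
by rewrite iterS avg_sym IH -iterSr.
Qed.

Lemma sum_delta x f : \sum_y delta x y * f y = f x.
Proof.
rewrite (bigD1 x) //= /delta eqxx mul1r big1 ?addr0 // => y yx.
by rewrite eq_sym (negbTE yx) mul0r.
Qed.

(** As [P] is self-adjoint, the squared norm of the four-step kernel is the eight-step return
    weight. *)
Lemma kernel_norm2 x : \sum_y avg4 (delta x) y ^+ 2 <= 105 * n%:R ^+ 4 / k%:R ^+ 8.
Proof.
have -> : \sum_y avg4 (delta x) y ^+ 2 = \sum_y delta x y * iter 8 average (delta x) y.
  rewrite (iterD 4 4) iter_avg_sym; apply: eq_bigr => y _; exact: expr2.
rewrite sum_delta -radial80; have /andP[_] := avg_radial 8 x x.
by rewrite distxx.
Qed.

Lemma fluct_split (p : R) h X (M : R) : (forall x, `|fluct V p (avg4 (delta x)) X| <= M) ->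
  fluct V p (fun x => h x - avg4 h x) X - norm1 h * M <= fluct V p h X.
Proof.
move=> hM; pose phi y : R := if y \in V then (y \in X)%:R - p else 0.
have FE w : fluct V p w X = \sum_y w y * phi y.
  rewrite /fluct big_mkcond; apply: eq_bigr => y _; rewrite /phi.
  by case: ifP => // _; rewrite mulr0.
have E : fluct V p h X = fluct V p (fun x => h x - avg4 h x) X +
    \sum_x h x * fluct V p (avg4 (delta x)) X.
  have -> : \sum_x h x * fluct V p (avg4 (delta x)) X = \sum_x avg4 h x * phi x.
    rewrite -iter_avg_sym; apply: eq_bigr => x _; rewrite FE -iter_avg_sym.
    by rewrite sum_delta.
  by rewrite !FE -big_split; apply: eq_bigr => x _ /=; ring.
rewrite E lerD2l lerNl -sumrN /norm1 mulr_suml; apply: ler_sum => x _.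
rewrite -mulrN; apply: le_trans (ler_norm _) _; rewrite normrM normrN.
by rewrite ler_wpM2l.
Qed.

End Averaging.

(** * Random subsets *)

From mathcomp Require Import all_classical all_reals all_analysis.
Import numFieldNormedType.Exports.

Section ExpBounds.
Variable R : realType.
Implicit Types x p r : R.

Lemma expR_le_addsq x : expR x <= x + expR (2 * x ^+ 2).
Proof.
have [hx|hx] := leP x (1 / 2).
  (* [exp x <= 1 / (1 - x) <= 1 + x + 2 x^2] *)
  have h1 : 1 - x <= expR (- x) by have := expR_ge1Dx (- x).
  have h2 : 1 + 2 * x ^+ 2 <= expR (2 * x ^+ 2) := expR_ge1Dx _.
  have h3 : expR x * expR (- x) = 1 by rewrite -expRD subrr expR0.
  have h4 := expR_gt0 x.
  suff : expR x <= 1 + x + 2 * x ^+ 2 by lra.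
  have h5 : expR x * (1 - x) <= 1 by rewrite -[leRHS]h3 ler_wpM2l // ltW.
  have h6 : 1 <= (1 + x + 2 * x ^+ 2) * (1 - x).
    have : 0 <= x ^+ 2 * (1 - 2 * x) by rewrite mulr_ge0 ?sqr_ge0 //; lra.
    by rewrite !expr2; lra.
  rewrite -(ler_pM2r (_ : 0 < 1 - x)); last lra.
  exact: le_trans h6.
have : expR x <= expR (2 * x ^+ 2).
  by rewrite ler_expR expr2; nra.
lra.
Qed.

(** In [expR_le_addsq] the linear terms cancel, since the variable is centred; its values are at
    most 1 in absolute value. *)
Lemma mgf_le p r : 0 <= p -> p <= 1 ->
  p * expR (r * (1 - p)) + (1 - p) * expR (r * (0 - p)) <= expR (2 * r ^+ 2).
Proof.
move=> p0 p1.
have h1 := expR_le_addsq (r * (1 - p)); have h2 := expR_le_addsq (r * (0 - p)).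
have q0 : 0 <= 1 - p by lra.
have m1 := ler_wpM2l p0 h1; have m2 := ler_wpM2l q0 h2.
have e y : y ^+ 2 <= 1 -> expR (2 * (r * y) ^+ 2) <= expR (2 * r ^+ 2).
  move=> hy; rewrite ler_expR exprMn; have := sqr_ge0 r; nra.
have e1 : expR (2 * (r * (1 - p)) ^+ 2) <= expR (2 * r ^+ 2) by apply: e; nra.
have e2 : expR (2 * (r * (0 - p)) ^+ 2) <= expR (2 * r ^+ 2) by apply: e; nra.
have n1 := ler_wpM2l p0 e1; have n2 := ler_wpM2l q0 e2.
lra.
Qed.

End ExpBounds.

Section Prob.
Variables (R : realType) (T : finType) (V : {set T}) (p : R).
Hypotheses (p0 : 0 <= p) (p1 : p <= 1).
Implicit Types (X : {set T}) (E : pred {set T}).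

Definition wt X : R := p ^+ #|X| * (1 - p) ^+ #|V :\: X|.

Lemma wt_ge0 X : 0 <= wt X.
Proof. by rewrite mulr_ge0 ?exprn_ge0 // subr_ge0. Qed.

Lemma expect_prod (a b : T -> R) :
  \sum_(X in powerset V) wt X * \prod_(x in V) (if x \in X then a x else b x)
  = \prod_(x in V) (p * a x + (1 - p) * b x).
Proof.
(* Extended by 0 and 1 outside [V], the product expands over all subsets, and those not included in
   [V] vanish. *)
pose F x := if x \in V then p * a x else 0.
pose G x := if x \in V then (1 - p) * b x else 1.
have -> : \prod_(x in V) (p * a x + (1 - p) * b x) = \prod_x (F x + G x).
  rewrite big_mkcond /=; apply: eq_bigr => x _; rewrite /F /G.
  by case: ifP => // _; rewrite add0r.
rewrite bigA_distr [RHS](bigID (mem (powerset V))) /= [X in _ = _ + X]big1 ?addr0; last first.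
  move=> X; rewrite powersetE => /subsetPn[x xX xV].
  by rewrite (bigD1 x) //= xX /F (negbTE xV) mul0r.
apply: eq_big => [X|X]; first by rewrite inE.
rewrite powersetE => XV.
have -> : wt X = \prod_(x in V) (if x \in X then p else 1 - p).
  rewrite (big_setID X) /= (finset.setIidPr XV).
  rewrite (eq_bigr (fun=> p)) ?prodr_const; last by move=> x ->.
  congr (_ * _); rewrite (eq_bigr (fun=> 1 - p)) ?prodr_const // => x.
  by rewrite finset.in_setD => /andP[/negbTE -> _].
rewrite -big_split /= big_mkcond /=; apply: eq_bigr => x _; rewrite /F /G.
case: ifP => xV; first by case: ifP.
by case: (boolP (x \in X)) => // xX; rewrite (fintype.subsetP XV) in xV.
Qed.

Lemma expect_one : \sum_(X in powerset V) wt X = 1.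
Proof.
have := expect_prod (fun=> 1) (fun=> 1).
rewrite [RHS]big1 => [<-|x _]; last by rewrite !mulr1 subrKC.
by apply: eq_bigr => X _; rewrite big1 ?mulr1 // => x _; case: ifP.
Qed.

Lemma ProbE E : Prob_subset V p E = \sum_(X in powerset V) (if E X then wt X else 0).
Proof. by rewrite /Prob_subset big_mkcondr. Qed.

Lemma Prob_compl E : 1 - Prob_subset V p E = Prob_subset V p (predC E).
Proof.
rewrite !ProbE -expect_one -sumrB; apply: eq_bigr => X _ /=.
by case: (E X) => /=; rewrite ?subrr ?subr0.
Qed.

Lemma Prob_ge0 E : 0 <= Prob_subset V p E.
Proof. by apply: sumr_ge0 => X _; apply: wt_ge0. Qed.

Lemma Prob_union (I : finType) (M : {set I}) E (Ei : I -> pred {set T}) :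
  (forall X, X \subset V -> E X -> exists2 i, i \in M & Ei i X) ->
  Prob_subset V p E <= \sum_(i in M) Prob_subset V p (Ei i).
Proof.
move=> h; rewrite ProbE (eq_bigr (fun i => \sum_(X in powerset V)
    (if Ei i X then wt X else 0))); last by move=> i _; rewrite ProbE.
rewrite exchange_big /=; apply: ler_sum => X; rewrite powersetE => XV.
have nn P : 0 <= \sum_(i in M | P i) (if Ei i X then wt X else 0).
  by apply: sumr_ge0 => i _; case: ifP => // _; apply: wt_ge0.
case: ifP => [/(h _ XV)[i iM hi]|_].
  by rewrite (bigD1 i) //= hi lerDl nn.
by apply: sumr_ge0 => i _; case: ifP => // _; apply: wt_ge0.
Qed.

Lemma Prob_unionU E E1 E2 : (forall X, X \subset V -> E X -> E1 X || E2 X) ->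
  Prob_subset V p E <= Prob_subset V p E1 + Prob_subset V p E2.
Proof.
move=> h; rewrite !ProbE -big_split /=; apply: ler_sum => X; rewrite powersetE => XV.
have w0 := wt_ge0 X; case: ifP => [/(h _ XV)/orP[->|->]|_].
- by rewrite lerDl; case: ifP.
- by rewrite lerDr; case: ifP.
- by apply: addr_ge0; case: ifP.
Qed.

Lemma Prob_le E E' : (forall X, X \subset V -> E X -> E' X) ->
  Prob_subset V p E <= Prob_subset V p E'.
Proof.
move=> h; rewrite !ProbE; apply: ler_sum => X; rewrite powersetE => XV.
have w0 := wt_ge0 X; case: ifP => [/(h _ XV) -> //|_]; by case: ifP.
Qed.

Lemma Prob_union_le (I : finType) (M : {set I}) E (Ei : I -> pred {set T}) (q : R) :
  (forall X, X \subset V -> E X -> exists2 i, i \in M & Ei i X) ->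
  (forall i, i \in M -> Prob_subset V p (Ei i) <= q) ->
  Prob_subset V p E <= #|M|%:R * q.
Proof.
move=> h hq; apply: le_trans (Prob_union h) _.
by rewrite mulr_natl -sumr_const; apply: ler_sum.
Qed.

Lemma Prob_markov E (phi : {set T} -> R) : (forall X, 0 <= phi X) ->
  (forall X, X \subset V -> E X -> 1 <= phi X) ->
  Prob_subset V p E <= \sum_(X in powerset V) wt X * phi X.
Proof.
move=> h0 h1; rewrite ProbE; apply: ler_sum => X; rewrite powersetE => XV.
have := wt_ge0 X; case: ifP => hE w0; last by rewrite mulr_ge0.
by rewrite ler_peMr // h1.
Qed.

Lemma hoeffding (w : T -> R) (l s : R) : 0 <= l -> 0 < s ->
  \sum_(x in V) w x ^+ 2 <= s ->
  Prob_subset V p (fun X => fluct V p w X <= - l) <= expR (- (l ^+ 2 / (8 * s))).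
Proof.
(* This [r] minimises the exponent [- r l + 2 r^2 s], with value [- l^2 / (8 s)]. *)
move=> l0 s0 hs; pose r := l / (4 * s).
have r0 : 0 <= r by rewrite divr_ge0 // mulr_ge0 // ltW.
pose phi X := expR (- r * l) * \prod_(x in V) (if x \in X then expR (- r * w x * (1 - p))
                                          else expR (- r * w x * (0 - p))).
have phiE X : phi X = expR (- r * (l + fluct V p w X)).
  rewrite /phi mulrDr expRD /fluct mulr_sumr expR_sum; congr (_ * _).
  by apply: eq_bigr => x _; case: (x \in X); rewrite mulrA.
apply: le_trans (@Prob_markov _ phi _ _) _.
- by move=> X; rewrite phiE expR_ge0.
- move=> X _ hX; rewrite phiE -[leLHS]expR0 ler_expR mulNr -mulrN mulr_ge0 //.
  by rewrite oppr_ge0; lra.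
under eq_bigr do rewrite mulrCA.
rewrite -mulr_sumr expect_prod.
apply: le_trans (_ : expR (- r * l) * \prod_(x in V) expR (2 * (- r * w x) ^+ 2) <= _).
  rewrite ler_wpM2l ?expR_ge0 //; apply: ler_prod => x _; rewrite mgf_le // andbT.
  by rewrite addr_ge0 // mulr_ge0 ?expR_ge0 // subr_ge0.
rewrite -expR_sum -expRD ler_expR.
have -> : \sum_(x in V) 2 * (- r * w x) ^+ 2 = 2 * r ^+ 2 * \sum_(x in V) w x ^+ 2.
  by rewrite mulr_sumr; apply: eq_bigr => x _; ring.
have : 2 * r ^+ 2 * \sum_(x in V) w x ^+ 2 <= 2 * r ^+ 2 * s.
  by rewrite ler_wpM2l // mulr_ge0 // sqr_ge0.
have : - r * l + 2 * r ^+ 2 * s = - (l ^+ 2 / (8 * s)).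
  by rewrite /r; field; rewrite gt_eqF.
lra.
Qed.

(** Exponential Markov inequality. As [s] grows the base tends to [1 - p], which is what small sets
    require; [hoeffding] cannot reach it. *)
Lemma lower_tail (G : {set T}) (m s : R) : G \subset V -> 0 <= s ->
  Prob_subset V p (fun X => #|G :&: X|%:R <= m)
  <= expR (s * m) * (1 - p + p * expR (- s)) ^+ #|G|.
Proof.
move=> GV s0.
pose phi X := expR (s * m) * \prod_(x in V) (if x \in X then
   (if x \in G then expR (- s) else 1) else 1).
have phiE X : X \subset V -> phi X = expR (s * (m - #|G :&: X|%:R)).
  move=> XV; rewrite /phi mulrBr expRD; congr (_ * _).
  have -> : expR (- (s * #|G :&: X|%:R)) = expR (- s) ^+ #|G :&: X|.
    by rewrite -mulNr -expRM_natr.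
  rewrite -prodr_const [LHS]big_mkcond [RHS]big_mkcond /=; apply: eq_bigr => x _.
  rewrite finset.in_setI; case: (boolP (x \in X)) => xX; last by rewrite andbF; case: ifP.
  by rewrite (fintype.subsetP XV) // andbT.
apply: le_trans (@Prob_markov _ phi _ _) _.
- move=> X; rewrite mulr_ge0 ?expR_ge0 //; apply: prodr_ge0 => x _.
  by case: ifP => // _; case: ifP => // _; rewrite expR_ge0.
- move=> X XV hX; rewrite phiE // -[leLHS]expR0 ler_expR mulr_ge0 //.
  by rewrite subr_ge0.
under eq_bigr do rewrite mulrCA.
rewrite -mulr_sumr expect_prod ler_wpM2l ?expR_ge0 //.
rewrite -prodr_const [leLHS]big_mkcond [leRHS]big_mkcond /=.
apply: ler_prod => x _; case: (boolP (x \in V)) => xV.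
  have q0 : 0 <= 1 - p by rewrite subr_ge0.
  have e0 := expR_ge0 (- s).
  case: ifP => _; last by rewrite !mulr1 subrKC ler01 lexx.
  by rewrite mulr1 addrC lexx andbT addr_ge0 // mulr_ge0.
case: ifP => xG; last by rewrite ler01 lexx.
by rewrite (fintype.subsetP GV) in xV.
Qed.

End Prob.

Lemma card_finset_type (T : finType) : #|{: {set T}}| = (2 ^ #|T|)%N.
Proof. by rewrite -[LHS]cardsT -powersetT card_powerset cardsT. Qed.

(** * Concentration for weights with small rough part *)

Section Concentration.
Variables (R : realType) (n k : nat) (e : rel {set 'I_n}) (V : {set {set 'I_n}}).
Hypothesis H : cube_graph k e V.
Hypothesis k0 : (0 < k)%N.
Hypothesis nk : (n <= 2 * k)%N.
Variable p : R.
Hypotheses (p0 : 0 <= p) (p1 : p <= 1).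
Implicit Types (x y : {set 'I_n}) (h : {set 'I_n} -> R) (X : {set {set 'I_n}}).

Local Notation avg := (average k e).
Local Notation avg4 := (avg4 k e).
Local Notation Pr := (Prob_subset V p).

Let kR : 0 < k%:R :> R.
Proof. by rewrite ltr0n. Qed.

(* [avg4 (delta R x)] is the kernel of four steps of the walk from [x]: its l2 norm
   is O(k^-2), so that a union bound over [x] is affordable. *)
Definition rough (m : R) X :=
  [exists x : {set 'I_n}, m / k%:R < `|fluct V p (avg4 (delta R x)) X|].

Lemma rough_prob (m : R) : 0 < m ->
  Pr (rough m) <= 2 * 2 ^+ n * expR (- (m ^+ 2 * k%:R ^+ 2 / 13440)).
Proof.
(* [1680 = 105 * 2^4], by [kernel_norm2] and [n <= 2 k]. *)
move=> m0; pose s : R := 1680 / k%:R ^+ 4.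
have s0 : 0 < s by rewrite divr_gt0 ?exprn_gt0 ?ltr0n.
have hs (w : {set 'I_n} -> R) x : (forall y, w y ^+ 2 = avg4 (delta R x) y ^+ 2) ->
    \sum_(y in V) w y ^+ 2 <= s.
  move=> hw; apply: le_trans (_ : \sum_y avg4 (delta R x) y ^+ 2 <= _).
    rewrite big_mkcond; apply: ler_sum => y _; rewrite hw.
    by case: ifP => // _; rewrite sqr_ge0.
  apply: le_trans (kernel_norm2 R H k0 x) _.
  have h4 : n%:R ^+ 4 <= (2 * k%:R) ^+ 4 :> R.
    by rewrite lerXn2r ?nnegrE ?mulr_ge0 ?ler0n // -natrM ler_nat.
  rewrite ler_pdivrMr ?exprn_gt0 // /s.
  have -> : 1680 / k%:R ^+ 4 * k%:R ^+ 8 = 105 * (2 * k%:R) ^+ 4 :> R.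
    by field; rewrite gt_eqF.
  by rewrite ler_wpM2l.
(* The sign turns the two-sided deviation into two lower deviations. *)
pose Ei (i : {set 'I_n} * bool) X := fluct V p (fun y => (-1) ^+ i.2 * avg4 (delta R i.1) y) X <= - (m / k%:R).
have := @Prob_union_le R _ V p p0 p1 _ [set: {set 'I_n} * bool] (rough m) Ei
  (expR (- (m ^+ 2 * k%:R ^+ 2 / 13440))).
rewrite cardsT card_prod card_finset_type card_ord card_bool natrM natrX [2 ^+ n * _]mulrC; apply.
- move=> X _ /existsP[x]; rewrite ltr_normr => /orP[hx|hx].
    exists (x, true) => //; rewrite /Ei /fluct /= expr1.
    under eq_bigr do rewrite mulN1r mulNr.
    by rewrite sumrN lerN2; apply: ltW.
  exists (x, false) => //; rewrite /Ei /fluct /= expr0.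
  under eq_bigr do rewrite mul1r.
  by rewrite lerNr; apply: ltW.
- move=> [x b] _; have hl : 0 <= m / k%:R by rewrite divr_ge0 ?ler0n // ltW.
  have := @hoeffding R _ V p p0 p1 (fun y => (-1) ^+ b * avg4 (delta R x) y) _ _ hl s0 _.
  have -> : (m / k%:R) ^+ 2 / (8 * s) = m ^+ 2 * k%:R ^+ 2 / 13440.
    by rewrite /s; field; rewrite gt_eqF.
  apply; apply: (hs _ x) => y; by rewrite exprMn sqrr_sign mul1r.
Qed.

Lemma avg_sup h (c : R) : (forall x, `|h x| <= c) -> forall x, `|avg h x| <= c.
Proof.
move=> hc x; have c0 : 0 <= c by apply: le_trans (hc x).
rewrite /average normrM gtr0_norm ?invr_gt0 // mulrC ler_pdivrMr //.
apply: le_trans (ler_norm_sum _ _ _) _.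
apply: le_trans (_ : \sum_(y in nbrs e x) c <= _); first by apply: ler_sum.
rewrite sumr_const -[leLHS]mulr_natr ler_wpM2l // ler_nat.
exact: card_nb_le H x.
Qed.

(** The sup and smoothing bounds control the variance, the crude l1 bound controls the smooth part.
    The constants are large enough for boundaries, container pairs and matched vertices alike. *)
Definition admissible (t : R) h :=
  [/\ forall x, `|h x| <= 2, norm1 (fun x => h x - avg4 h x) <= 16 * t
    & norm1 h <= 10 * k%:R * t].

(** Half of [d t] is allotted to the smooth part, at most [10 k t * d / (20 k)]. The rest has values
    at most 4 and l1 norm at most [16 t], hence squared l2 norm at most [64 t], and [hoeffding]
    applies. *)
Lemma admissible_conc (t d : R) h : 0 < t -> 0 < d -> admissible t h ->
  Pr (fun X => ~~ rough (d / 20) X && (fluct V p h X <= - (d * t)))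
  <= expR (- (d ^+ 2 / 2048 * t)).
Proof.
move=> t0 d0 [hsup hsm hn].
pose w x := h x - avg4 h x.
have w4 x : `|w x| <= 4.
  apply: le_trans (ler_normB _ _) _.
  have : `|avg4 h x| <= 2 by do 4 (apply: avg_sup => {}x).
  by have := hsup x; lra.
have hw : \sum_(x in V) w x ^+ 2 <= 64 * t.
  apply: le_trans (_ : 4 * norm1 w <= _); last by rewrite -/w in hsm; lra.
  rewrite /norm1 mulr_sumr big_mkcond; apply: ler_sum => x _.
  case: ifP => _; last by rewrite mulr_ge0.
  by rewrite -real_normK ?num_real // expr2 ler_wpM2r.
have l0 : 0 <= d * t / 2 by rewrite !mulr_ge0 ?invr_ge0 // ltW.
have s0 : 0 < 64 * t by rewrite mulr_gt0.
have := @hoeffding R _ V p p0 p1 w _ _ l0 s0 hw.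
have -> : (d * t / 2) ^+ 2 / (8 * (64 * t)) = d ^+ 2 / 2048 * t.
  by field; rewrite gt_eqF.
apply: le_trans; apply: (Prob_le p0 p1) => X _ /andP[/existsPn hr hf].
have hM x : `|fluct V p (avg4 (delta R x)) X| <= d / 20 / k%:R.
  by have := hr x; rewrite -leNgt.
have := fluct_split H h hM; rewrite -/w => hsp.
have : norm1 h * (d / 20 / k%:R) <= d * t / 2.
  apply: le_trans (_ : 10 * k%:R * t * (d / 20 / k%:R) <= _).
    by rewrite ler_wpM2r // !divr_ge0 ?ler0n // ltW.
  by rewrite le_eqVlt; apply/orP; left; apply/eqP; field; rewrite gt_eqF.
lra.
Qed.

End Concentration.

Lemma pow2_le_expR (R : realType) m : 2 ^+ m <= expR m%:R :> R.
Proof.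
rewrite -[m%:R]mul1r expRM_natr lerXn2r ?nnegrE ?expR_ge0 //.
by have := expR_ge1Dx (1 : R).
Qed.

(** * Admissible weights and the deterministic expansion argument *)

Section Expansion.
Variables (R : realType) (n k : nat) (e : rel {set 'I_n}) (V Y Y2 : {set {set 'I_n}}).
Hypothesis H : cube_graph k e V.
Hypothesis k8 : (8 <= k)%N.
Hypothesis n0 : (0 < n)%N.
Hypothesis nk : (n <= 2 * k)%N.
Hypothesis YV : Y \subset V.
Hypothesis YY2 : forall x y, e x y -> x \in Y -> y \in Y2.
Variable p : R.
Hypotheses (p0 : 1 < 2 * p) (p1 : p <= 1).
Implicit Types (A B F S X : {set {set 'I_n}}) (h : {set 'I_n} -> R).

Local Notation avg := (average k e).
Local Notation avg4 := (avg4 k e).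
Local Notation Pr := (Prob_subset V p).
Local Notation N := (nbhd e).
Local Notation ind := (indf R).

Let k0 : (0 < k)%N. Proof. by apply: leq_trans k8. Qed.
Let kR : 0 < k%:R :> R. Proof. by rewrite ltr0n. Qed.
Let p_ge0 : 0 <= p. Proof. by move: p0; lra. Qed.

Lemma fluct_ind B X : B \subset V -> fluct V p (ind B) X = #|B :&: X|%:R - p * #|B|%:R.
Proof.
move=> BV; rewrite /fluct.
under eq_bigr do rewrite mulrBr.
rewrite sumrB; congr (_ - _).
  rewrite -sum1_card natr_sum [LHS]big_mkcond [RHS]big_mkcond /=; apply: eq_bigr => x _.
  rewrite finset.in_setI /indf; case: (boolP (x \in B)) => xB.
    by rewrite (fintype.subsetP BV) // mul1r; case: (x \in X).
  by rewrite mul0r; case: ifP.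
rewrite mulrC -mulr_suml; congr (_ * _).
rewrite -sum1_card natr_sum [LHS]big_mkcond [RHS]big_mkcond /=; apply: eq_bigr => x _.
rewrite /indf; case: (boolP (x \in B)) => xB; last by case: ifP.
by rewrite (fintype.subsetP BV).
Qed.

Lemma fluctD h1 h2 X : fluct V p (fun x => h1 x + h2 x) X = fluct V p h1 X + fluct V p h2 X.
Proof. by rewrite /fluct -big_split; apply: eq_bigr => x _; rewrite mulrDl. Qed.

Lemma fluctB h1 h2 X : fluct V p (fun x => h1 x - h2 x) X = fluct V p h1 X - fluct V p h2 X.
Proof. by rewrite /fluct -sumrB; apply: eq_bigr => x _; rewrite mulrBl. Qed.

Lemma norm1_ind B : norm1 (ind B) = #|B|%:R :> R.
Proof.
rewrite -(sum_ind R B); apply: eq_bigr => x _; rewrite ger0_norm //.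
Qed.

Lemma admissible_bdry A (t : R) : A \subset V -> #|N A|%:R - #|A|%:R = t -> 0 <= t ->
  #|A|%:R <= 2 * k%:R * t -> admissible k e t (bdry R e A).
Proof.
move=> AV ht t0 ha; split.
- by move=> x; rewrite /bdry /indf; case: (_ \in _); case: (_ \in _);
    rewrite ?subrr ?subr0 ?sub0r ?normrN ?normr1 ?normr0 //; lra.
- apply: le_trans (smooth_bdry H k0 _) _.
  by have := bdry_norm1 R H k0 AV; rewrite ht; lra.
- have E : norm1 (bdry R e A) <= #|N A|%:R + #|A|%:R.
    apply: le_trans (norm1D (ind (N A)) (fun x => - ind A x)) _.
    by rewrite norm1N !norm1_ind.
  have k1 : 1 <= k%:R :> R by rewrite ler1n.
  have : 1 * t <= k%:R * t by rewrite ler_wpM2r.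
  lra.
Qed.

(** The weight differs from the boundary of [A] by [g], of l1 norm at most [4 t]. Smoothing costs
    [8 t] for the boundary and, by the trivial bound, [8 t] for [g]. *)
Lemma admissible_pair A F S (t : R) : A \subset V -> #|N A|%:R - #|A|%:R = t -> 0 <= t ->
  #|A|%:R <= 2 * k%:R * t -> F \subset N A -> A \subset S ->
  #|N A :\: F|%:R <= 2 * t -> #|S :\: A|%:R <= 2 * t ->
  admissible k e t (fun x => ind F x - ind S x).
Proof.
move=> AV ht t0 ha FG AS hF hS; have [_ h2 h3] := admissible_bdry AV ht t0 ha.
have k1 : 1 <= k%:R :> R by rewrite ler1n.
have kt : 1 * t <= k%:R * t by rewrite ler_wpM2r.
pose g x := - (ind (N A :\: F) x + ind (S :\: A) x).
have hE x : ind F x - ind S x = bdry R e A x + g x.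
  rewrite /g /bdry /indf !finset.in_setD.
  have h1 := fintype.subsetP FG x; have h4 := fintype.subsetP AS x.
  case: (x \in F) h1; case: (x \in N A); case: (x \in A) h4; case: (x \in S) => h4 h1 /=;
    try (by have := h1 isT); try (by have := h4 isT); lra.
have gn : norm1 g <= 4 * t.
  rewrite norm1N; apply: le_trans (norm1D _ _) _; rewrite !norm1_ind; lra.
split.
- by move=> x; rewrite /indf; case: (_ \in _); case: (_ \in _);
    rewrite ?subrr ?subr0 ?sub0r ?normrN ?normr1 ?normr0 //; lra.
- pose b x : R := bdry R e A x - avg4 (bdry R e A) x.
  pose g' x : R := g x - avg4 g x.
  have E x : (ind F x - ind S x) - avg4 (fun x => ind F x - ind S x) x = b x + g' x.
    have E4 : avg4 (fun x => ind F x - ind S x) x = avg4 (bdry R e A) x + avg4 g x.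
      have a1 := fun y => etrans (eq_avg k e hE y) (avgD k e _ _ y).
      have a2 := fun y => etrans (eq_avg k e a1 y) (avgD k e _ _ y).
      have a3 := fun y => etrans (eq_avg k e a2 y) (avgD k e _ _ y).
      exact: etrans (eq_avg k e a3 x) (avgD k e _ _ x).
    by rewrite hE E4 /b /g'; ring.
  rewrite (eq_norm1 E); apply: le_trans (norm1D _ _) _.
  have := smooth_le H k0 g; have := smooth_bdry H k0 (bdry R e A).
  have := bdry_norm1 R H k0 AV; rewrite ht -/b -/g'; lra.
- have fF : #|F|%:R <= #|N A|%:R :> R by rewrite ler_nat subset_leq_card.
  have fS : #|S|%:R = #|A|%:R + #|S :\: A|%:R :> R.
    by rewrite -natrD -(cardsID A S) (finset.setIidPr AS).
  apply: le_trans (norm1D (ind F) (fun x => - ind S x)) _.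
  rewrite norm1N !norm1_ind fS; lra.
Qed.

Lemma admissible_small B1 B2 (t : R) : 0 <= t -> #|B1|%:R + #|B2|%:R <= 8 * t ->
  admissible k e t (fun x => ind B1 x + ind B2 x).
Proof.
move=> t0 hB.
have k1 : 1 <= k%:R :> R by rewrite ler1n.
have kt : 1 * t <= k%:R * t by rewrite ler_wpM2r.
have hn : norm1 (fun x => ind B1 x + ind B2 x) <= 8 * t.
  by apply: le_trans (norm1D _ _) _; rewrite !norm1_ind.
split.
- move=> x; rewrite /indf ger0_norm ?addr_ge0 ?ler0n // -natrD (ler_nat R _ 2).
  by case: (_ \in _); case: (_ \in _).
- by have := smooth_le H k0 (fun x => ind B1 x + ind B2 x); lra.
- lra.
Qed.

(** By [balance] the quantity equals [|F :&: X| - |S :&: X|] plus the points of [X] in [S :\: A] and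
    [N A :\: F]. If the matching is large, the latter number at least [(2 p - 1) mu - d t], while
    the former is at least [- (2 p - 1) e1 t / 4 - d t]; half of [(2 p - 1) e1 t] survives. *)
Lemma expand_det A F S X (t c d e1 psi : R) :
  A \subset V -> F \subset N A -> A \subset S -> S \subset V ->
  0 < e1 -> #|N A|%:R - #|A|%:R = t -> 0 <= t -> mtgt e F S \subset V ->
  k%:R * #|S|%:R <= k%:R * #|F|%:R + 4 * psi * t ->
  4 * psi <= (2 * p - 1) * e1 / 4 * k%:R -> d = (2 * p - 1) * e1 / 8 ->
  c <= 1 / 4 -> c <= (2 * p - 1) * e1 / 2 ->
  - (d * t) <= fluct V p (fun x => ind F x - ind S x) X ->
  - (d * t) <= fluct V p (fun x => ind (msrc e F S) x + ind (mtgt e F S) x) X ->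
  (#|matching e F S|%:R <= e1 * t -> - (1 / 4 * t) <= fluct V p (bdry R e A) X) ->
  c * t <= #|N A :&: X|%:R - #|A :&: X|%:R.
Proof.
move=> AV FG AS SV e10 ht t0 mV hSF hpsi hd c1 c2 f1 f2 f3.
have GV := nbhd_sub H A.
have FV : F \subset V := fintype.subset_trans FG GV.
have [hmu|hmu] := leP (#|matching e F S|%:R) (e1 * t).
  (* With few matching edges the fluctuation of [A] itself is controlled, and the mean [p t] exceeds
     [t / 2], so losing [t / 4] is affordable. *)
  have := f3 hmu; rewrite /bdry fluctB !fluct_ind // => f.
  have : c * t <= 1 / 4 * t by rewrite ler_wpM2r.
  have : 1 * t <= 2 * p * t by rewrite ler_wpM2r // ltW.
  have : p * (#|N A|%:R - #|A|%:R) = p * t by rewrite ht.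
  lra.
have mS : msrc e F S \subset V := fintype.subset_trans (msrc_sub e F S) SV.
have hcov u v : u \in S -> v \notin F -> e u v -> (u \in S :\: A) || (v \in N A :\: F).
  move=> uS vF uv; rewrite !finset.in_setD uS vF /= andbT.
  have [uA|//] := boolP (u \in A); apply/(nbhdP H); exists u => //.
  by rewrite inE.
have := matching_cover X hcov.
have := balance X FG AS.
move=> /(congr1 (fun m => m%:R : R)); rewrite !natrD => hb.
rewrite -(ler_nat R) !natrD => hm.
move: f1 f2; rewrite fluctB fluctD !fluct_ind // card_msrc card_mtgt.
move: hb hm hSF; set mu : R := #|matching e F S|%:R in hmu *.
move=> hb hm hSF f1 f2.
have eta0 : 0 <= 2 * p - 1 by rewrite subr_ge0 ltW.
have q1 : #|S|%:R - #|F|%:R <= (2 * p - 1) * e1 / 4 * t.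
  have h : 4 * psi * t <= (2 * p - 1) * e1 / 4 * k%:R * t by rewrite ler_wpM2r.
  by rewrite -(ler_pM2l kR) mulrBr; lra.
have q2 : p * (#|S|%:R - #|F|%:R) <= (2 * p - 1) * e1 / 4 * t.
  have [hneg|hpos] := lerP (#|S|%:R - #|F|%:R : R) 0.
    have : p * (#|S|%:R - #|F|%:R) <= 0 by rewrite mulr_ge0_le0.
    have : 0 <= (2 * p - 1) * e1 / 4 * t.
      by rewrite !mulr_ge0 // ltW.
    lra.
  by apply: le_trans q1; rewrite ler_piMl // ltW.
have q3 : (2 * p - 1) * (e1 * t) <= (2 * p - 1) * mu by rewrite ler_wpM2l // ltW.
have q4 : c * t <= (2 * p - 1) * e1 / 2 * t by rewrite ler_wpM2r.
have q5 : d * t = (2 * p - 1) * e1 * t / 8 by rewrite hd; ring.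
lra.
Qed.

End Expansion.

(** One walk and four masks, for the parts [T0], [R0], [T1] and [T2] of a fingerprint. *)
Definition mask_code n l : finType :=
  (({set 'I_n} * l.-tuple 'I_n) *
   ((l.+1.-tuple bool * l.+1.-tuple bool) * (l.+1.-tuple bool * l.+1.-tuple bool)))%type.

Lemma card_mask_code n l : #|mask_code n l| = (2 ^ n * n ^ l * 2 ^ (4 * l.+1))%N.
Proof.
rewrite !card_prod card_finset_type !card_tuple !card_ord card_bool -!expnD.
by congr (_ * 2 ^ _)%N; lia.
Qed.

(** * The union bound over containers *)

Section UnionBounds.
Variables (R : realType) (n k : nat) (e : rel {set 'I_n}) (V Y Y2 : {set {set 'I_n}}).
Hypothesis H : cube_graph k e V.
Hypothesis n0 : (0 < n)%N.
Hypothesis nk : (n <= 2 * k)%N.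
Hypothesis YV : Y \subset V.
Hypothesis YY2 : forall x y, e x y -> x \in Y -> y \in Y2.
Variable p : R.
Hypotheses (p0 : 1 < 2 * p) (p1 : p <= 1).
Implicit Types (A B F S X : {set {set 'I_n}}) (h : {set 'I_n} -> R).

Local Notation Pr := (Prob_subset V p).
Local Notation N := (nbhd e).
Local Notation ind := (indf R).
Local Notation mask_code := (mask_code n).

Let p_ge0 : 0 <= p. Proof. by move: p0; lra. Qed.

Definition code_out psi l (i : mask_code l) :=
  cont_out e Y psi (picked i.1 i.2.1.1) (picked i.1 i.2.1.2)
                   (picked i.1 i.2.2.1) (picked i.1 i.2.2.2).
Definition code_in psi l (i : mask_code l) :=
  cont_in e Y Y2 psi (picked i.1 i.2.1.1) (picked i.1 i.2.1.2)
                     (picked i.1 i.2.2.1) (picked i.1 i.2.2.2).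

(** The bound on [#|A|] is the expansion hypothesis [|N A| >= (1 + 1 / (2 k)) |A|] in integer
    form. *)
Definition sparse_bad (c : R) (t : nat) X :=
  [exists A : {set {set 'I_n}},
    [&& A \subset Y, nbhd_closed e Y A, two_linked e A,
        (#|N A| - #|A| == t)%N, (#|A| <= 2 * k * t)%N &
        ~~ (c * t%:R <= #|N A :&: X|%:R - #|A :&: X|%:R)]].

(** Failure of the three fluctuation hypotheses of [expand_det] is bounded separately; each costs
    one union over the codes. *)
Lemma sparse_bad_prob (c d e1 : R) t l psi beta j D :
  (8 <= k)%N -> (0 < beta)%N -> (beta * beta <= k)%N -> (k <= 2 ^ j)%N ->
  (2 * psi <= k)%N -> (k <= D * psi.+1)%N -> (k <= t)%N ->
  (forall q, beta * q <= (194 * j + 39 * D + 26) * t -> 36 * q <= l)%N ->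
  0 < e1 -> 4 * e1 = (1 / 4) ^+ 2 / 2048 ->
  4 * psi%:R <= (2 * p - 1) * e1 / 4 * k%:R -> d = (2 * p - 1) * e1 / 8 ->
  c <= 1 / 4 -> c <= (2 * p - 1) * e1 / 2 ->
  Pr (fun X => ~~ rough k e V p (d / 20) X && sparse_bad c t X)
  <= 3 * #|mask_code l|%:R * expR (- (d ^+ 2 / 2048 * t%:R)).
Proof.
move=> k8 b0 bb kj psik hD kt hl e10 e1E hpsi hd c1 c2.
have k0 : (0 < k)%N by apply: leq_trans k8.
have kR : 0 < k%:R :> R by rewrite ltr0n.
have tR : 0 < t%:R :> R by rewrite ltr0n (leq_trans k0).
have eta0 : 0 < 2 * p - 1 by rewrite subr_gt0.
have eta1 : 2 * p - 1 <= 1 by move: p1; lra.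
have d0 : 0 < d by rewrite hd !mulr_gt0.
have e1s : e1 <= 1 / 4 by rewrite !expr2 in e1E; lra.
have d1 : d <= e1 / 8.
  by rewrite hd ler_wpM2r // -[leRHS]mul1r ler_wpM2r // ltW.
pose h1 (i : mask_code l) x := ind (code_in psi i) x - ind (code_out psi i) x.
pose h2 (i : mask_code l) x := ind (msrc e (code_in psi i) (code_out psi i)) x
                             + ind (mtgt e (code_in psi i) (code_out psi i)) x.
pose q := expR (- (d ^+ 2 / 2048 * t%:R)).
pose ev h (s : R) X := ~~ rough k e V p (s / 20) X && (fluct V p h X <= - (s * t%:R)).
(* Concentration is available for admissible weights only, so the events range over the codes with
   admissible weight; the code of an actual [A] is one of them. *)
pose E1 X := [exists i, `[< admissible k e t%:R (h1 i) >] && ev (h1 i) d X].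
pose E2 X := [exists i, `[< admissible k e t%:R (h2 i) >] && ev (h2 i) d X].
pose dec (i : mask_code l) (z : {set {set 'I_n}} * {set {set 'I_n}}) :=
  cover_decode e (code_in psi i) (code_out psi i) z.1 z.2.
pose zs (i : mask_code l) := finset.setX (powerset (msrc e (code_in psi i) (code_out psi i)))
                  (powerset (mtgt e (code_in psi i) (code_out psi i))).
pose small (i : mask_code l) := #|matching e (code_in psi i) (code_out psi i)|%:R <= e1 * t%:R.
pose E3i (i : mask_code l) X := [exists z, (z \in zs i) &&
   (`[< admissible k e t%:R (bdry R e (dec i z)) >] && ev (bdry R e (dec i z)) (1 / 4) X)].
pose E3 X := [exists i, small i && E3i i X].
have b1 : Pr E1 <= #|mask_code l|%:R * q.
  pose M := [set i | `[< admissible k e t%:R (h1 i) >]].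
  apply: le_trans (@Prob_union_le R _ V p p_ge0 p1 _ M _ (fun i => ev (h1 i) d) q _ _) _.
  - by move=> X _ /existsP[i /andP[hi he]]; exists i => //; rewrite inE.
  - by move=> i; rewrite inE => /asboolP hi; exact: (admissible_conc H k0 p_ge0 p1 tR d0 hi).
  - by rewrite ler_wpM2r ?expR_ge0 // ler_nat max_card.
have b2 : Pr E2 <= #|mask_code l|%:R * q.
  pose M := [set i | `[< admissible k e t%:R (h2 i) >]].
  apply: le_trans (@Prob_union_le R _ V p p_ge0 p1 _ M _ (fun i => ev (h2 i) d) q _ _) _.
  - by move=> X _ /existsP[i /andP[hi he]]; exists i => //; rewrite inE.
  - by move=> i; rewrite inE => /asboolP hi; exact: (admissible_conc H k0 p_ge0 p1 tR d0 hi).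
  - by rewrite ler_wpM2r ?expR_ge0 // ler_nat max_card.
have b3 : Pr E3 <= #|mask_code l|%:R * q.
  pose M := [set i | small i].
  apply: le_trans (@Prob_union_le R _ V p p_ge0 p1 _ M _ E3i q _ _) _.
  - by move=> X _ /existsP[i /andP[hi he]]; exists i => //; rewrite inE.
  - move=> i; rewrite inE => hi.
    pose Mi := [set z in zs i | `[< admissible k e t%:R (bdry R e (dec i z)) >]].
    pose qi := expR (- ((1 / 4) ^+ 2 / 2048 * t%:R)) : R.
    apply: le_trans (@Prob_union_le R _ V p p_ge0 p1 _ Mi _
      (fun z => ev (bdry R e (dec i z)) (1 / 4)) qi _ _) _.
    + by move=> X _ /existsP[z /and3P[hz ha he]]; exists z => //; rewrite inE hz.
    + move=> z; rewrite inE => /andP[_ /asboolP hz].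
      have q0 : 0 < 1 / 4 :> R by rewrite divr_gt0.
      exact: (admissible_conc H k0 p_ge0 p1 tR q0 hz).
    set mu := #|matching e (code_in psi i) (code_out psi i)|.
    have hM : (#|Mi| <= 2 ^ (2 * mu))%N.
      apply: leq_trans (_ : #|zs i| <= _)%N.
        by apply: subset_leq_card; apply/fintype.subsetP => z; rewrite inE => /andP[].
      by rewrite cardsX !card_powerset card_msrc card_mtgt -expnD addnn mul2n.
    (* The traces on the matching number at most [4^mu], hence at most [exp (2 e1 t)], while
       concentration at level [1 / 4] gives [exp (- 4 e1 t)]. *)
    apply: le_trans (_ : expR (2 * mu)%:R * qi <= _).
      rewrite ler_wpM2r ?expR_ge0 //; apply: le_trans (pow2_le_expR R _).
      by rewrite -natrX ler_nat.
    rewrite -expRD ler_expR -e1E natrM -/mu in hi *.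
    have : d ^+ 2 / 2048 <= e1.
      have d2 : d <= e1 by move: d1 e10; lra.
      have d3 : d <= 1 by move: d2 e1s; lra.
      have := ler_pM (ltW d0) (ltW d0) d2 d3; rewrite -expr2; move: e10; lra.
    move/(ler_wpM2r (ltW tR)); have := mulr_gt0 e10 tR; rewrite /small -/mu in hi; move: hi; lra.
  - by rewrite ler_wpM2r ?expR_ge0 // ler_nat max_card.
have -> : 3 * #|mask_code l|%:R * q = #|mask_code l|%:R * q + (#|mask_code l|%:R * q + #|mask_code l|%:R * q) by ring.
apply: le_trans (@Prob_unionU R _ V p p_ge0 p1 _ E1 (fun X => E2 X || E3 X) _) _; last first.
  by apply: lerD b1 _; apply: le_trans (@Prob_unionU R _ V p p_ge0 p1 _ E2 E3 _) (lerD b2 b3).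
move=> X XV /andP[hr /existsP[A /andP[AY /and5P[hcl hlk /eqP ht ha hbad]]]].
have AV : A \subset V := fintype.subset_trans AY YV.
have [Q [T0 [R0 [T1 [T2 [hQ hlink hcQ hcont]]]]]] :
  exists Q T0 R0 T1 T2 : {set {set 'I_n}},
  let F := cont_in e Y Y2 psi T0 R0 T1 T2 in let S := cont_out e Y psi T0 R0 T1 T2 in
  [/\ [/\ T0 \subset Q, R0 \subset Q, T1 \subset Q & T2 \subset Q],
      forall C : {set {set 'I_n}}, C \subset Q -> C != finset.set0 -> C != Q ->
        exists x y, [/\ x \in C, y \in Q :\: C & (dist x y <= 18)%N],
      (beta * #|Q| <= (194 * j + 39 * D + 26) * t)%N &
      [/\ F \subset N A, A \subset S, (k * #|S| <= k * #|F| + 4 * psi * t)%N,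
          (#|N A :\: F| <= 2 * t)%N & (#|S :\: A| <= 2 * t)%N]].
  have := @container_exists n k e V H Y Y2 A AV AY YV YY2 psi beta j D hcl hlk k8 nk b0 bb kj psik hD.
  by rewrite ht; apply.
have [i hi] : exists i : mask_code l, [/\ picked i.1 i.2.1.1 = T0, picked i.1 i.2.1.2 = R0,
     picked i.1 i.2.2.1 = T1 & picked i.1 i.2.2.2 = T2].
  (* Detours of up to 18 flips, each retraced, account for the factor 36. *)
  have [|cc hcc] := @linked_code n 18 l Q n0 _ hlink; first exact: hl hcQ.
  case: hQ => /hcc[m1 hm1] /hcc[m2 hm2] /hcc[m3 hm3] /hcc[m4 hm4].
  by exists (cc, ((m1, m2), (m3, m4))).
have [FG AS hSF hGF hSA] : [/\ code_in psi i \subset N A, A \subset code_out psi i,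
   (k * #|code_out psi i| <= k * #|code_in psi i| + 4 * psi * t)%N,
   (#|N A :\: code_in psi i| <= 2 * t)%N & (#|code_out psi i :\: A| <= 2 * t)%N].
  by rewrite /code_in /code_out; case: hi => -> -> -> ->.
have hag := card_le_nbhd H AV k0.
have htR : #|N A|%:R - #|A|%:R = t%:R :> R by rewrite -natrB // ht.
have haR : #|A|%:R <= 2 * k%:R * t%:R :> R by rewrite -!natrM ler_nat.
have SY : code_out psi i \subset Y.
  apply/fintype.subsetP => u; rewrite /code_out /cont_out finset.in_setD => /andP[_].
  by rewrite inE => /andP[].
have hGFR : #|N A :\: code_in psi i|%:R <= 2 * t%:R :> R by rewrite -natrM ler_nat.
have hSAR : #|code_out psi i :\: A|%:R <= 2 * t%:R :> R by rewrite -natrM ler_nat.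
have SV := fintype.subset_trans SY YV.
have mV : mtgt e (code_in psi i) (code_out psi i) \subset V.
  apply/fintype.subsetP => v /imsetP[m /matchingP[_ _ hm] ->].
  by apply: (cg_sub H (y := m.1)); rewrite (cg_sym H).
apply: contraR hbad; rewrite !negb_or => /and3P[n1 n2 n3].
apply: (@expand_det R n k e V H k8 p p0 p1 A (code_in psi i) (code_out psi i) X t%:R c d e1 psi%:R) => //.
- by rewrite -!natrM -natrD ler_nat.
- rewrite leNgt; apply: contra n1 => hlt; apply/existsP; exists i.
  rewrite /ev hr (ltW hlt) !andbT; apply/asboolP.
  exact: (admissible_pair H k8 AV htR (ltW tR) haR FG AS hGFR hSAR).
- rewrite leNgt; apply: contra n2 => hlt; apply/existsP; exists i.
  rewrite /ev hr (ltW hlt) !andbT; apply/asboolP.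
  apply: (admissible_small H k8 (ltW tR)); rewrite card_msrc card_mtgt.
  have hcov u v : u \in code_out psi i -> v \notin code_in psi i -> e u v ->
      (u \in code_out psi i :\: A) || (v \in N A :\: code_in psi i).
    move=> uS vF uv; rewrite (finset.in_setD _ _ u) uS (finset.in_setD _ _ v) vF /= andbT.
    have [uA|//] := boolP (u \in A); apply/(nbhdP H); exists u => //.
    by rewrite inE.
  have := matching_card hcov; rewrite -(ler_nat R) natrD.
  by move: hGFR hSAR; lra.
- move=> hsm; rewrite leNgt; apply: contra n3 => hlt; apply/existsP; exists i.
  rewrite /small hsm /=; apply/existsP.
  have [Z1 [Z2 [hZ1 hZ2 hdec]]] := decode_closed (cg_sym H) hcl AS FG SY AY.
  exists (Z1, Z2); rewrite /dec /= hdec finset.in_setX /= !powersetE hZ1 hZ2 /=.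
  (* As [d <= 1 / 4], not being rough at the smaller threshold is the stronger condition. *)
  have ra : ~~ rough k e V p (1 / 4 / 20) X.
    apply: contra hr => /existsP[x hx]; apply/existsP; exists x.
    by apply: le_lt_trans hx; rewrite !ler_wpM2r ?invr_ge0 ?ler0n //; move: d1 e1s; lra.
  rewrite /ev ra (ltW hlt) !andbT; apply/asboolP.
  exact: (admissible_bdry H k8 AV htR (ltW tR) haR).
Qed.

End UnionBounds.

(** * Sets of bounded size *)

Section SmallSets.
Variables (R : realType) (n k : nat) (e : rel {set 'I_n}) (V Y : {set {set 'I_n}}).
Hypothesis H : cube_graph k e V.
Hypothesis n0 : (0 < n)%N.
Hypothesis k0 : (0 < k)%N.
Hypothesis YV : Y \subset V.
Variable p : R.
Hypotheses (p0 : 0 <= p) (p1 : p <= 1).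
Implicit Types (A X : {set {set 'I_n}}).

Local Notation Pr := (Prob_subset V p).
Local Notation N := (nbhd e).

Lemma nbhd_card2 A : A \subset V -> (1 < #|A|)%N -> (2 * k - 2 <= #|N A|)%N.
Proof.
move=> AV /card_gt1P[x [y [xA yA xy]]].
pose B := [set x; y].
have BA : B \subset A by apply/fintype.subsetP => z; rewrite !inE => /orP[] /eqP ->.
have := card_nbhd_small H (fintype.subset_trans BA AV).
rewrite cards2 xy /=; have := subset_leq_card (nbhdS H BA).
by rewrite -/B; move: #|N B| #|N A| => a b; clear; lia.
Qed.

Definition small_bad (c : R) (s : nat) X :=
  [exists A : {set {set 'I_n}},
    [&& A \subset Y, two_linked e A, (1 < #|A|)%N, (#|A| <= s)%N &
        ~~ (c * (#|N A|%:R - #|A|%:R) <= #|N A :&: X|%:R - #|A :&: X|%:R)]].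

(** Failure for [|A| <= s] forces [|N A :&: X| <= s + c |N A|], and [lower_tail] yields a factor
    [rho] for each of at least [2 k - 2] vertices of [N A]. A 2-linked [A] is a net of radius 1 for
    its own neighbourhood, so walks with detours of 4 flips encode it. *)
Lemma small_bad_prob (c z rho : R) s l : 0 <= c -> 0 <= z ->
  expR (z * c) * (1 - p + p * expR (- z)) = rho -> rho <= 1 -> (8 * s <= l)%N ->
  Pr (small_bad c s) <= (2 ^ n * n ^ l * 2 ^ l.+1)%N%:R * (expR (z * s%:R) * rho ^+ (2 * k - 2)).
Proof.
move=> c0 z0 hrho rho1 hl.
have r0 : 0 <= 1 - p + p * expR (- z).
  by rewrite addr_ge0 ?subr_ge0 // mulr_ge0 // expR_ge0.
have rho0 : 0 <= rho by rewrite -hrho mulr_ge0 // expR_ge0.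
pose I : finType := (({set 'I_n} * l.-tuple 'I_n) * l.+1.-tuple bool)%type.
pose Ai (i : I) := picked i.1 i.2.
pose M := [set i | [&& Ai i \subset V, (1 < #|Ai i|)%N & (#|Ai i| <= s)%N]].
pose Ei i X := #|N (Ai i) :&: X|%:R <= s%:R + c * #|N (Ai i)|%:R :> R.
apply: le_trans (@Prob_union_le R _ V p p0 p1 _ M _ Ei
  (expR (z * s%:R) * rho ^+ (2 * k - 2)) _ _) _.
- move=> X _ /existsP[A /and5P[AY hlk h1 hs hbad]].
  have AV : A \subset V := fintype.subset_trans AY YV.
  have hlink := @net_linked n k e V H A 1 A hlk _ _.
  have [||cc hcc] := @linked_code n 4 l A n0.
  - by apply: leq_trans hl; rewrite -[X in (_ <= X * _)%N]/(2 * 4)%N leq_mul2l hs.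
  - apply: hlink.
      move=> v /(nbhdP H)[u uA uv]; exists u => //.
      by rewrite distC (nb_dist H uv).
    move=> u uA; have [v hv] := nb_neq0 H k0 (fintype.subsetP AV _ uA).
    exists v; first exact: (fintype.subsetP (nb_nbhd H uA)).
    by rewrite distC (nb_dist H hv).
  have [b hb] := hcc _ (fintype.subxx A).
  exists (cc, b); first by rewrite inE /Ai hb AV h1 hs.
  rewrite /Ei /Ai hb; move: hbad; rewrite -ltNge => hbad.
  have a1 : #|A :&: X|%:R <= s%:R :> R.
    by rewrite ler_nat (leq_trans _ hs) // subset_leq_card // finset.subsetIl.
  have a2 : 0 <= c * #|A|%:R by rewrite mulr_ge0.
  lra.
- move=> i; rewrite inE => /and3P[AV h1 hs].
  apply: le_trans (lower_tail p0 p1 _ (nbhd_sub H (Ai i)) z0) _.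
  have -> : expR (z * (s%:R + c * #|N (Ai i)|%:R)) = expR (z * s%:R) * expR (z * c) ^+ #|N (Ai i)|.
    by rewrite mulrDr expRD mulrA [expR (z * c * _)]expRM_natr.
  rewrite -mulrA -exprMn hrho.
  rewrite ler_wpM2l ?expR_ge0 // ler_wiXn2l //.
  exact: nbhd_card2.
- rewrite ler_wpM2r ?mulr_ge0 ?expR_ge0 ?exprn_ge0 // ler_nat.
  apply: leq_trans (max_card _) _.
  by rewrite !card_prod card_finset_type !card_tuple !card_ord card_bool.
Qed.

End SmallSets.

(** * Asymptotics *)

Section Asymptotics.
Variable R : realType.

(** The term of order [m + 2] of the exponential series leaves O(k^-2). *)
Lemma expR_beats_poly (C a d : R) m : 0 <= C -> 0 < a -> 0 < d ->
  exists k0, forall k, (k0 <= k)%N -> (0 < k)%N ->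
    C * k%:R ^+ m * expR (- (a * k%:R)) <= d / k%:R.
Proof.
move=> C0 a0 d0; pose f : R := m.+2`!%:R; pose B := C * f / a ^+ m.+2.
have f0 : 0 < f by rewrite ltr0n fact_gt0.
have B0 : 0 <= B / d.
  apply: divr_ge0 (ltW d0); apply: divr_ge0; last by rewrite exprn_ge0 // ltW.
  exact: mulr_ge0 C0 (ltW f0).
exists (Num.bound (B / d)) => k hk k0.
have kR : 0 < k%:R :> R by rewrite ltr0n.
have ak : 0 < a * k%:R by rewrite mulr_gt0.
have hB : B / d <= k%:R.
  by apply: le_trans (ltW (archi_boundP B0)) _; rewrite ler_nat.
have hE : (a * k%:R) ^+ m.+2 / f <= expR (a * k%:R).
  by have := expR_ge1Dxn m.+1 (ltW ak); rewrite -/f; lra.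
have hX : 0 < (a * k%:R) ^+ m.+2 by rewrite exprn_gt0.
have hN : expR (- (a * k%:R)) <= f / (a * k%:R) ^+ m.+2.
  rewrite expRN -[f / _]invrK invf_div lef_pV2 ?posrE ?expR_gt0 ?divr_gt0 //.
apply: le_trans (_ : C * k%:R ^+ m * (f / (a * k%:R) ^+ m.+2) <= _).
  by rewrite ler_wpM2l // mulr_ge0 // exprn_ge0 // ltW.
have -> : C * k%:R ^+ m * (f / (a * k%:R) ^+ m.+2) = B / k%:R / k%:R.
  rewrite /B exprMn !exprS; field.
  by rewrite !gt_eqF // exprn_gt0.
rewrite ler_wpM2r ?invr_ge0 ?ler0n // ler_pdivrMr //.
by move: hB; rewrite ler_pdivrMr // mulrC.
Qed.

Lemma cube_le_pow2 h : (h ^ 3 <= 10 * 2 ^ h)%N.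
Proof.
elim: h => // h IH; case: (leqP h 3) => hh; first by case: h hh {IH} => [|[|[|[|h]]]].
have : (h.+1 ^ 3 <= 2 * h ^ 3)%N by rewrite !expnS !expn0 !muln1; nia.
by rewrite [(2 ^ h.+1)%N]expnS; lia.
Qed.

(** [beta] is a power of two of order [sqrt k] and [j] is about [log k], so the square of [j] is
    eventually negligible against [beta]. *)
Lemma scale_choice (C a : R) : 0 < C -> 0 < a ->
  exists k0, forall k, (k0 <= k)%N ->
  exists beta j, [/\ (0 < beta)%N, (beta * beta <= k)%N, (k <= 2 ^ j)%N &
    C * j.+1%:R ^+ 2 <= a * beta%:R].
Proof.
(* [250 = 25 * 10]: the first factor from [j.+1 <= 5 h], the second from [cube_le_pow2]. *)
move=> C0 a0; have B0 : 0 <= 250 * C / a := divr_ge0 (mulr_ge0 (ler0n R 250) (ltW C0)) (ltW a0).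
pose h0 := (Num.bound (250 * C / a)).+1.
exists (2 ^ (2 * h0))%N => k hk.
have k0 : (0 < k)%N by apply: leq_trans hk; rewrite expn_gt0.
pose L := trunc_log 2 k; pose h := L./2.
have hL1 : (2 ^ L <= k)%N by apply: trunc_logP.
have hL2 : (k < 2 ^ L.+1)%N by apply: trunc_log_ltn.
have h2 : (h.*2 <= L)%N by rewrite -[X in (_ <= X)%N](odd_double_half L) leq_addl.
have h3 : (L <= h.*2.+1)%N.
  by rewrite -[X in (X <= _)%N](odd_double_half L) -add1n leq_add2r; case: (odd L).
exists (2 ^ h)%N, L.+1; split; rewrite ?expn_gt0 //.
- by rewrite -expnD addnn; apply: leq_trans hL1; rewrite leq_exp2l.
- exact: ltnW.
have hh : (h0 <= h)%N.
  have : (2 ^ (2 * h0) < 2 ^ L.+1)%N by apply: leq_ltn_trans hL2.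
  by rewrite ltn_exp2l //; lia.
have hR : 250 * C / a <= h%:R.
  apply: le_trans (ltW (archi_boundP B0)) _; rewrite ler_nat.
  by apply: leq_trans hh; rewrite /h0.
have h1 : 1 <= h%:R :> R by rewrite ler1n (leq_trans _ hh).
have l1 : L.+2%:R <= 5 * h%:R :> R.
  have hp : (0 < h)%N by apply: leq_trans hh.
  by rewrite -natrM ler_nat; clear -hp h3; lia.
have l2 : L.+2%:R ^+ 2 <= 25 * h%:R ^+ 2 :> R.
  have -> : 25 * h%:R ^+ 2 = (5 * h%:R) ^+ 2 :> R by ring.
  by rewrite lerXn2r ?nnegrE ?mulr_ge0 ?ler0n.
have l3 : h%:R ^+ 3 <= 10 * (2 ^ h)%N%:R :> R.
  by rewrite -natrX -natrM ler_nat cube_le_pow2.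
have l4 : 250 * C * h%:R ^+ 2 <= a * h%:R ^+ 3.
  rewrite [_ ^+ 3]exprS mulrA ler_wpM2r ?sqr_ge0 //.
  by move: hR; rewrite ler_pdivrMr // [_ * a]mulrC.
have l5 : a * h%:R ^+ 3 <= a * (10 * (2 ^ h)%N%:R) by rewrite ler_wpM2l // ltW.
have l6 : C * L.+2%:R ^+ 2 <= C * (25 * h%:R ^+ 2) by rewrite ler_wpM2l // ltW.
lra.
Qed.

End Asymptotics.

(** * Failure probability for one side of the bipartition *)

Section Side.
Variables (R : realType) (n k : nat) (e : rel {set 'I_n}) (V Y Y2 : {set {set 'I_n}}).
Hypothesis H : cube_graph k e V.
Hypothesis n0 : (0 < n)%N.
Hypothesis nk : (n <= 2 * k)%N.
Hypothesis YV : Y \subset V.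
Hypothesis YY2 : forall x y, e x y -> x \in Y -> y \in Y2.
Variable p : R.
Hypotheses (p0 : 1 < 2 * p) (p1 : p <= 1).
Implicit Types (A X : {set {set 'I_n}}).

Local Notation Pr := (Prob_subset V p).
Local Notation N := (nbhd e).

Let p_ge0 : 0 <= p. Proof. by move: p0; lra. Qed.

Definition side_bad (c : R) X :=
  [exists A : {set {set 'I_n}},
    [&& A \subset Y, nbhd_closed e Y A, two_linked e A, (1 < #|A|)%N &
      ((1 + (2 * k%:R)^-1) * #|A|%:R <= #|N A|%:R :> R) &&
        ~~ (c * (#|N A|%:R - #|A|%:R) <= #|N A :&: X|%:R - #|A :&: X|%:R)]].

Lemma side_bad_split (c : R) K X : (0 < k)%N -> ((4 * K + 8) ^ 2 <= k)%N -> side_bad c X ->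
  small_bad e Y c (4 * K + 2) X \/
  exists t : 'I_(2 ^ n).+1, (K * k <= t)%N && sparse_bad k e Y c t X.
Proof.
move=> k0 hK /existsP[A /and5P[AY hcl hlk h1 /andP[hexp hbad]]].
have AV : A \subset V := fintype.subset_trans AY YV.
have kR : 0 < k%:R :> R by rewrite ltr0n.
have hag := card_le_nbhd H AV k0.
have ha : (#|A| <= 2 * k * (#|N A| - #|A|))%N.
  rewrite -(ler_nat R) 2!natrM natrB //.
  have hE : #|A|%:R = 2 * k%:R * ((1 + (2 * k%:R)^-1) * #|A|%:R - #|A|%:R) :> R.
    by field; rewrite gt_eqF.
  by rewrite [leLHS]hE ler_wpM2l ?mulr_ge0 ?ler0n // lerD2r.
have [ht|ht] := ltnP (#|N A| - #|A|) (K * k)%N.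
  left; apply/existsP; exists A; rewrite AY hlk h1 hbad andbT /=.
  exact: ltnW (small_bdry H k0 AV nk hK ht ha).
right; have hb : (#|N A| - #|A| < (2 ^ n).+1)%N.
  rewrite ltnS; apply: leq_trans (leq_subr _ _) _; apply: leq_trans (max_card _) _.
  by rewrite card_finset_type card_ord.
exists (Ordinal hb); rewrite ht /=; apply/existsP; exists A.
by rewrite AY hcl hlk eqxx ha natrB.
Qed.

(** As [n <= 2^(j + 1)], each flip together with its four mask bits costs at most [j + 5] bits. *)
Lemma mask_code_le l j : (k <= 2 ^ j)%N ->
  #|mask_code n l|%:R <= expR (n + 4 + (j + 5) * l)%N%:R :> R.
Proof.
move=> kj; apply: le_trans (pow2_le_expR R _).
rewrite -natrX ler_nat card_mask_code.
have -> : (2 ^ (4 * l.+1) = 2 ^ 4 * (2 ^ 4) ^ l)%N by rewrite -expnM -expnD; congr expn; lia.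
rewrite mulnACA [(n ^ l * _)%N]mulnC -expnMn -expnD.
have h : (2 ^ 4 * n <= 2 ^ (j + 5))%N.
  rewrite addnC expnD; apply: leq_trans (leq_mul (leqnn _) nk) _.
  by rewrite mulnA leq_mul2l kj orbT.
rewrite [X in (_ <= X)%N]expnD leq_mul2l expnM; apply/orP; right.
by have [->|l0] := posnP l; rewrite ?expn0 // leq_exp2r.
Qed.

(** For [t >= K k] the code entropy uses at most half of the exponent [kap t]; the remaining
    [exp (- 12 k)] outweighs the at most [2 exp (2 k)] values of [t]. *)
Lemma side_bad_prob (c d e1 z rho : R) K l psi beta j D :
  (8 <= k)%N -> ((4 * K + 8) ^ 2 <= k)%N -> (0 < K)%N ->
  (0 < beta)%N -> (beta * beta <= k)%N -> (k <= 2 ^ j)%N ->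
  (2 * psi <= k)%N -> (k <= D * psi.+1)%N ->
  0 < e1 -> 4 * e1 = (1 / 4) ^+ 2 / 2048 ->
  4 * psi%:R <= (2 * p - 1) * e1 / 4 * k%:R -> d = (2 * p - 1) * e1 / 8 ->
  0 <= c -> c <= 1 / 4 -> c <= (2 * p - 1) * e1 / 2 ->
  24 <= d ^+ 2 / 2048 * K%:R ->
  (720 * (39 * D + 220))%N%:R * j.+1%:R ^+ 2 <= d ^+ 2 / 2048 * beta%:R ->
  0 <= z -> expR (z * c) * (1 - p + p * expR (- z)) = rho -> rho <= 1 ->
  (8 * (4 * K + 2) <= l)%N ->
  Pr (fun X => ~~ rough k e V p (d / 20) X && side_bad c X)
  <= (2 ^ n * n ^ l * 2 ^ l.+1)%N%:R * (expR (z * (4 * K + 2)%N%:R) * rho ^+ (2 * k - 2))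
   + 6 * expR (- k%:R).
Proof.
move=> k8 hK K0 b0 bb kj psik hD e10 e1E hpsi hd c0 c1 c2 hkap hbeta z0 hrho rho1 hl.
have k0 : (0 < k)%N by apply: leq_trans k8.
have kR : 0 < k%:R :> R by rewrite ltr0n.
pose kap := d ^+ 2 / 2048; rewrite -/kap in hkap hbeta.
have kap0 : 0 <= kap := divr_ge0 (sqr_ge0 d) (ler0n R 2048).
pose Et X := [exists t : 'I_(2 ^ n).+1, (K * k <= t)%N &&
   (~~ rough k e V p (d / 20) X && sparse_bad k e Y c t X)].
apply: le_trans (@Prob_unionU R _ V p p_ge0 p1 _ (small_bad e Y c (4 * K + 2)) Et _) _.
  move=> X XV /andP[hr /(side_bad_split k0 hK)[->//|[t /andP[ht hs]]]].
  by apply/orP; right; apply/existsP; exists t; rewrite ht hr hs.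
apply: lerD.
  exact: (small_bad_prob H n0 k0 YV p_ge0 p1 c0 z0 hrho rho1 hl).
pose M := [set t : 'I_(2 ^ n).+1 | (K * k <= t)%N].
apply: le_trans (@Prob_union_le R _ V p p_ge0 p1 _ M _
  (fun t X => ~~ rough k e V p (d / 20) X && sparse_bad k e Y c t X)
  (3 * expR (- (12 * k%:R))) _ _) _.
- by move=> X _ /existsP[t /andP[ht hX]]; exists t => //; rewrite inE.
- move=> t; rewrite inE => ht.
  have kt : (k <= t)%N by apply: leq_trans ht; rewrite leq_pmull.
  pose Cj := (194 * j + 39 * D + 26)%N.
  pose lt := (36 * (Cj * t %/ beta))%N.
  have hlt q : (beta * q <= Cj * t -> 36 * q <= lt)%N.
    by move=> hq; rewrite leq_mul2l /= leq_divRL // mulnC.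
  apply: le_trans (sparse_bad_prob H n0 nk YV YY2 p0 p1 k8 b0 bb kj psik hD kt hlt e10 e1E hpsi hd c1 c2) _.
  rewrite -mulrA ler_wpM2l //; apply: le_trans (_ : expR (n + 4 + (j + 5) * lt)%N%:R * expR (- (kap * t%:R)) <= _).
    by rewrite ler_wpM2r ?expR_ge0 // mask_code_le.
  rewrite -expRD ler_expR natrD natrM.
  have tR : 0 <= t%:R :> R by [].
  have bR : 0 < beta%:R :> R by rewrite ltr0n.
  have f1 : (n + 4)%N%:R <= 6 * k%:R :> R.
    by rewrite -natrM ler_nat; clear -nk k8; lia.
  have f2 : 24 * k%:R <= kap * t%:R.
    apply: le_trans (_ : kap * K%:R * k%:R <= _); first by rewrite ler_wpM2r // ltW.
    by rewrite -mulrA -natrM ler_wpM2l // ler_nat.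
  have f3 : (j + 5)%N%:R * lt%:R * 4 <= kap * t%:R.
    rewrite -(ler_pM2r bR).
    have g1 : lt%:R * beta%:R <= 36 * Cj%:R * t%:R :> R.
      rewrite -!natrM ler_nat /lt -!mulnA leq_mul2l /=; exact: leq_divM.
    (* [36 * 4 * 5 = 720], from [j + 5 <= 5 (j + 1)] and [194 j + 39 D + 26 <= (39 D + 220) (j +
       1)]. *)
    have g2 : (j + 5)%N%:R * 4 * (36 * Cj%:R) <= (720 * (39 * D + 220))%N%:R * j.+1%:R ^+ 2 :> R.
      rewrite -natrX -!natrM ler_nat /Cj -mulnn; clear; nia.
    have g3 : (j + 5)%N%:R * 4 * (36 * Cj%:R) <= kap * beta%:R := le_trans g2 hbeta.
    have j0 : 0 <= (j + 5)%N%:R * 4 :> R by rewrite mulr_ge0.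
    have := ler_wpM2l j0 g1; have := ler_wpM2r tR g3; lra.
  lra.
have hM : #|M|%:R <= 2 * expR (2 * k%:R) :> R.
  apply: le_trans (_ : (2 ^ n).+1%:R <= _).
    by rewrite ler_nat (leq_trans (max_card _)) // card_ord.
  apply: le_trans (_ : 2 * 2 ^+ (2 * k) <= _).
    rewrite -natrX -natrM ler_nat; apply: leq_trans (_ : 2 ^ n + 2 ^ n <= _)%N.
      by rewrite -addn1 leq_add2l expn_gt0.
    by rewrite addnn -mul2n leq_mul2l leq_exp2l.
  by rewrite ler_wpM2l // -natrM pow2_le_expR.
apply: le_trans (_ : 2 * expR (2 * k%:R) * (3 * expR (- (12 * k%:R))) <= _).
  by rewrite ler_wpM2r ?mulr_ge0 ?expR_ge0.
have -> : 2 * expR (2 * k%:R) * (3 * expR (- (12 * k%:R))) = 6 * expR (2 * k%:R + - (12 * k%:R)) :> R.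
  by rewrite expRD; ring.
rewrite ler_wpM2l // ler_expR; lra.
Qed.

End Side.

(** * Choice of constants and conclusion *)

Section Final.
Variables (R : realType) (p : R).
Hypotheses (p0 : 1 < 2 * p) (p1 : p <= 1).

Let p_ge0 : 0 <= p. Proof. by move: p0; lra. Qed.

Lemma expanding_fail_le k (c d : R) :
  1 - Prob_subset (vertices k) p (@expanding_event R k c) <=
  Prob_subset (vertices k) p (rough k (adj k) (vertices k) p (d / 20)) +
  (Prob_subset (vertices k) p (fun X => ~~ rough k (adj k) (vertices k) p (d / 20) X
       && side_bad k (adj k) (upper k) c X) +
   Prob_subset (vertices k) p (fun X => ~~ rough k (adj k) (vertices k) p (d / 20) X
       && side_bad k (adj k) (lower k) c X)).
Proof.
rewrite Prob_compl.
pose ev Y X := ~~ rough k (adj k) (vertices k) p (d / 20) X && side_bad k (adj k) Y c X.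
apply: le_trans (@Prob_unionU R _ _ p p_ge0 p1 _ (rough k (adj k) (vertices k) p (d / 20))
  (fun X => ev (upper k) X || ev (lower k) X) _) _; last first.
  by rewrite lerD2l; apply: (@Prob_unionU R _ _ p p_ge0 p1 _ (ev (upper k)) (ev (lower k))) => X _.
move=> X _ /=; rewrite /ev; case: (rough _ _ _ _ _ _) => //=.
rewrite /expanding_event => /forallPn[Y]; rewrite negb_imply => /andP[hY /forallPn[A]].
rewrite negb_imply => /andP[/and5P[h1 h2 h3 h4 h5] h6].
have hs : side_bad k (adj k) Y c X.
  by apply/existsP; exists A; rewrite h1 h2 h3 h4 h5 h6.
by move: hY hs; rewrite !inE => /orP[] /eqP -> ->; rewrite ?orbT.
Qed.

(** The factor 2 matches the roughly [4^k] walk starts against [2 k - 2] Chernoff factors. With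
    [eta = 2 p - 1] and [exp (- z) = eta / 4] the doubled base is at most [(1 + eta / 2) (1 - eta /
    2) = 1 - eta^2 / 4]. *)
Lemma small_rate : exists z c0 a : R, [/\ 0 <= z, 0 < c0, 0 < a &
  forall c, 0 <= c -> c <= c0 ->
    2 * (expR (z * c) * (1 - p + p * expR (- z))) <= expR (- a)].
Proof.
pose eta := 2 * p - 1.
have eta0 : 0 < eta by rewrite subr_gt0.
have eta1 : eta <= 1 by rewrite /eta; move: p1; lra.
have q0 : 0 < eta / 4 by rewrite divr_gt0.
pose z := - ln (eta / 4).
have z0 : 0 < z by rewrite oppr_gt0 ln_lt0 // q0; lra.
have hz : expR (- z) = eta / 4 by rewrite opprK lnK.
pose c0 := ln (1 + eta / 2) / z.
have l0 : 0 < ln (1 + eta / 2) by rewrite ln_gt0; lra.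
exists z, c0, (eta ^+ 2 / 4); split.
- exact: ltW.
- by rewrite divr_gt0.
- by rewrite divr_gt0 // exprn_gt0.
move=> c c_ge0 hc; rewrite hz.
have h1 : expR (z * c) <= 1 + eta / 2.
  have pos : 1 + eta / 2 \is Num.pos by rewrite posrE; lra.
  rewrite -[leRHS](lnK pos) ler_expR.
  by move: hc; rewrite /c0 ler_pdivlMr // mulrC.
have h2 : 0 <= 1 - p + p * (eta / 4) by rewrite addr_ge0 ?subr_ge0 // mulr_ge0 // ltW.
have h3 : 1 - p + p * (eta / 4) <= 1 / 2 - eta / 4.
  have : p * (eta / 4) <= 1 * (eta / 4) by rewrite ler_wpM2r // ltW.
  by rewrite /eta; lra.
have h4 : expR (z * c) * (1 - p + p * (eta / 4)) <= (1 + eta / 2) * (1 / 2 - eta / 4).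
  by apply: ler_pM => //; exact: expR_ge0.
have := expR_ge1Dx (- (eta ^+ 2 / 4)); rewrite expr2; lra.
Qed.

Lemma small_term_le n k l (s : nat) (z rho a : R) : (n <= 2 * k)%N -> (2 <= k)%N ->
  0 <= rho -> 2 * rho <= expR (- a) -> 0 <= a ->
  (2 ^ n * n ^ l * 2 ^ l.+1)%N%:R * (expR (z * s%:R) * rho ^+ (2 * k - 2)) <=
  (4 * 2 ^ l * 2 ^ l.+1)%N%:R * expR (z * s%:R) * k%:R ^+ l * expR (- (a * k%:R)).
Proof.
move=> nk k2 rho0 hrho a0.
have h1 : (2 ^ n * n ^ l * 2 ^ l.+1 <= 4 * 2 ^ l * 2 ^ l.+1 * k ^ l * 2 ^ (2 * k - 2))%N.
  have e1 : (2 ^ n <= 4 * 2 ^ (2 * k - 2))%N.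
    by rewrite -[4%N]/(2 ^ 2)%N -expnD leq_exp2l //; lia.
  have e2 : (n ^ l <= 2 ^ l * k ^ l)%N.
    by rewrite -expnMn; have [->|l0] := posnP l; rewrite ?expn0 // leq_exp2r.
  have := leq_mul (leq_mul e1 e2) (leqnn (2 ^ l.+1)); lia.
have h2 : (2 * rho) ^+ (2 * k - 2) <= expR (- (a * k%:R)).
  apply: le_trans (_ : expR (- a) ^+ (2 * k - 2) <= _).
    by rewrite lerXn2r ?nnegrE ?mulr_ge0 ?expR_ge0.
  rewrite -expRM_natr ler_expR mulNr lerN2 ler_wpM2l // ler_nat; lia.
rewrite -(ler_nat R) in h1.
have r0 : 0 <= expR (z * s%:R) * rho ^+ (2 * k - 2) by rewrite mulr_ge0 ?expR_ge0 ?exprn_ge0.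
apply: le_trans (ler_wpM2r r0 h1) _.
rewrite !natrM !natrX; rewrite exprMn in h2.
set C := 4 * _ * _.
have -> : C * k%:R ^+ l * 2 ^+ (2 * k - 2) * (expR (z * s%:R) * rho ^+ (2 * k - 2)) =
  C * expR (z * s%:R) * k%:R ^+ l * (2 ^+ (2 * k - 2) * rho ^+ (2 * k - 2)) by ring.
by rewrite ler_wpM2l // !mulr_ge0 ?expR_ge0 ?exprn_ge0.
Qed.

(** [psi] is the integer part of [theta k]; the point is that the ratio bound [D] does not depend on
    [k]. *)
Lemma psi_choice (theta : R) k : 0 < theta -> theta <= 1 / 2 ->
  exists psi, [/\ psi%:R <= theta * k%:R, (2 * psi <= k)%N &
    (k <= Num.bound theta^-1 * psi.+1)%N].
Proof.
move=> th0 th1; have hD : theta^-1 < (Num.bound theta^-1)%:R.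
  by apply: archi_boundP; rewrite invr_ge0 ltW.
pose psi := Num.truncn (theta * k%:R).
have /andP[ps1 ps2] : psi%:R <= theta * k%:R < psi.+1%:R.
  by apply: truncn_itv; rewrite mulr_ge0 // ltW.
exists psi; split => //; rewrite -(ler_nat R) natrM.
  have : theta * k%:R <= 1 / 2 * k%:R by rewrite ler_wpM2r.
  by clear -ps1; lra.
have -> : k%:R = theta^-1 * (theta * k%:R) :> R by rewrite mulKf // gt_eqF.
by apply: ler_pM; rewrite ?invr_ge0 ?mulr_ge0 ?(ltW th0) ?(ltW hD) ?(ltW ps2).
Qed.

Lemma sum_bound (r B u s1 s2 T q : R) : r <= B -> B <= 2 * u ->
  s1 <= T + 6 * u -> s2 <= T + 6 * u -> 2 * T <= q -> 14 * u <= q -> r + (s1 + s2) <= q + q.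
Proof. lra. Qed.

Lemma expanding_fail_small : exists2 c : R, 0 < c & forall eps : R, 0 < eps ->
  exists k0, forall k, (k0 <= k)%N ->
    1 - Prob_subset (vertices k) p (@expanding_event R k c) <= eps / k%:R.
Proof.
have [z [c0 [a [z0 c00 a0 hz]]]] := small_rate.
pose eta := 2 * p - 1; pose e1 : R := (1 / 4) ^+ 2 / 2048 / 4.
have eta0 : 0 < eta by rewrite subr_gt0.
(* The constants are fixed in the order [e1], [d], [kap], [c], [theta], [D], [K], [l], all before
   [k]; [e1] is such that concentration at level [1 / 4] pays for the matching traces. *)
have eta1 : eta <= 1 by rewrite /eta; move: p1; lra.
have e10 : 0 < e1.
  have q4 : 0 < 4 :> R by rewrite ltr0n.
  have qD : 0 < 2048 :> R by rewrite ltr0n.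
  exact: divr_gt0 (divr_gt0 (exprn_gt0 2 (divr_gt0 ltr01 q4)) qD) q4.
have e1E : 4 * e1 = (1 / 4) ^+ 2 / 2048 by rewrite /e1; field.
have ee0 : 0 < eta * e1 by rewrite mulr_gt0.
have ee1 : eta * e1 <= 1.
  have h : eta * e1 <= 1 * e1 by rewrite ler_wpM2r // ltW.
  by rewrite expr2 in e1E; clear -h e1E; lra.
pose d := eta * e1 / 8; have d0 : 0 < d by rewrite divr_gt0.
pose kap := d ^+ 2 / 2048.
have kap0 : 0 < kap.
  have qD : 0 < 2048 :> R by rewrite ltr0n.
  exact: divr_gt0 (exprn_gt0 2 d0) qD.
pose c := Num.min (Num.min (1 / 4) (eta * e1 / 2)) c0.
have c_gt0 : 0 < c by rewrite !lt_min c00 !divr_gt0.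
have [cA cB cC] : [/\ c <= 1 / 4, c <= eta * e1 / 2 & c <= c0].
  by rewrite /c !ge_min !lexx ?orbT.
exists c => // eps eps0.
pose theta := eta * e1 / 16; have th0 : 0 < theta by rewrite divr_gt0.
have th1 : theta <= 1 / 2 by move: ee1; rewrite /theta; clear; lra.
pose D := Num.bound theta^-1.
have [K K0 hK] : exists2 K, (0 < K)%N & 24 <= kap * K%:R.
  exists (Num.bound (24 / kap)).+1 => //.
  have q : 0 <= 24 / kap by rewrite divr_ge0 // ltW.
  have := archi_boundP q; rewrite ltr_pdivrMr // => hq.
  have : (Num.bound (24 / kap))%:R * kap <= (Num.bound (24 / kap)).+1%:R * kap by rewrite ler_wpM2r ?(ltW kap0) // ler_nat.
  by move: hq; clear; lra.
have [l hl] : exists l, (8 * (4 * K + 2) <= l)%N by exists (8 * (4 * K + 2))%N.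
pose CC : R := (720 * (39 * D + 220))%N%:R.
have CC0 : 0 < CC by rewrite ltr0n muln_gt0 addn_gt0 orbT.
have [k1 hk1] := scale_choice CC0 kap0.
have [C3 C30 C3E] : exists2 C3 : R, 0 <= C3 &
    C3 = (4 * 2 ^ l * 2 ^ l.+1)%N%:R * expR (z * (4 * K + 2)%N%:R).
  by eexists; last reflexivity; rewrite mulr_ge0 ?expR_ge0.
have C30' : 0 <= 2 * C3 by rewrite mulr_ge0.
have eps2 : 0 < eps / 2 by rewrite divr_gt0.
have [k2 hk2] := expR_beats_poly l C30' a0 eps2.
(* [14 = 2 + 6 + 6]: the rough event and the two sides. *)
have [k3 hk3] := @expR_beats_poly R 14 1 (eps / 2) 0 (ler0n _ _) ltr01 eps2.
pose m := d / 20; have m0 : 0 < m by rewrite divr_gt0.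
(* From here on the exponent of [rough_prob] is at least [3 k], and [2 k] of it absorb the [2^n]
   centres. *)
pose k4 := Num.bound (3 * 13440 / m ^+ 2).
exists (maxn 8 (maxn k1 (maxn k2 (maxn k3 (maxn k4 ((4 * K + 8) ^ 2)))))) => k.
rewrite !geq_max => /and5P[k8 g1 g2 g3 /andP[g4 g5]].
have k0 : (0 < k)%N by apply: leq_trans k8.
have kR : 0 < k%:R :> R by rewrite ltr0n.
have H := middle_cube_graph k0.
have n0 : (0 < 2 * k - 1)%N by clear -k0; lia.
have nk : (2 * k - 1 <= 2 * k)%N by rewrite leq_subr.
have uV : upper k \subset vertices k := finset.subsetUl _ _.
have lV : lower k \subset vertices k := finset.subsetUr _ _.
have [beta [j [b0 bb kj hb]]] := hk1 k g1.
have [psi [ps1 psik hDk]] := psi_choice k th0 th1.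
have hpsi : 4 * psi%:R <= (2 * p - 1) * e1 / 4 * k%:R.
  have -> : (2 * p - 1) * e1 / 4 * k%:R = 4 * (theta * k%:R) by rewrite /theta /eta; field.
  by rewrite ler_wpM2l.
pose rho := expR (z * c) * (1 - p + p * expR (- z)).
have rho0 : 0 <= rho.
  by rewrite mulr_ge0 ?expR_ge0 // addr_ge0 ?subr_ge0 // mulr_ge0 ?expR_ge0.
have hrho : 2 * rho <= expR (- a) := hz c (ltW c_gt0) cC.
have rho1 : rho <= 1.
  have h : expR (- a) <= 1 by rewrite expR_le1 oppr_le0 ltW.
  by clear -h hrho rho0; lra.
have side (Y Y2 : {set {set 'I_(2 * k - 1)}}) : Y \subset vertices k -> (forall x y, adj k x y -> x \in Y -> y \in Y2) ->
    Prob_subset (vertices k) p (fun X => ~~ rough k (adj k) (vertices k) p (d / 20) X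
       && side_bad k (adj k) Y c X) <=
    C3 * (k%:R ^+ l * expR (- (a * k%:R))) + 6 * expR (- k%:R).
  move=> YV YY2.
  apply: le_trans (side_bad_prob H n0 nk YV YY2 p0 p1 k8 g5 K0 b0 bb kj psik hDk
    e10 e1E hpsi erefl (ltW c_gt0) cA cB hK hb z0 erefl rho1 hl) _.
  rewrite lerD2r; apply: le_trans (small_term_le _ _ _ nk _ rho0 hrho (ltW a0)) _.
    exact: leq_trans k8.
  by rewrite C3E !mulrA.
apply: le_trans (expanding_fail_le k c d) _.
have b1 := rough_prob H k0 nk p_ge0 p1 m0; rewrite -/m.
have b2 := side (upper k) (lower k) uV (@adj_upper k k0).
have b3 := side (lower k) (upper k) lV (@adj_lower k k0).
have b4 : 2 * 2 ^+ (2 * k - 1) * expR (- (m ^+ 2 * k%:R ^+ 2 / 13440)) <= 2 * expR (- k%:R) :> R.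
  rewrite -mulrA ler_wpM2l //.
  apply: le_trans (_ : expR (2 * k%:R) * expR (- (m ^+ 2 * k%:R ^+ 2 / 13440)) <= _).
    rewrite ler_wpM2r ?expR_ge0 //; apply: le_trans (pow2_le_expR R _) _.
    by rewrite ler_expR -natrM ler_nat.
  rewrite -expRD ler_expR.
  have q : 0 <= 3 * 13440 / m ^+ 2 :=
    divr_ge0 (mulr_ge0 (ler0n R 3) (ler0n R 13440)) (sqr_ge0 m).
  have hm : 3 * 13440 <= k%:R * m ^+ 2.
    rewrite -ler_pdivrMr ?exprn_gt0 //; apply: le_trans (ltW (archi_boundP q)) _.
    by rewrite ler_nat.
  have := ler_wpM2r (ltW kR) hm.
  by rewrite [k%:R ^+ 2]expr2; clear; lra.
have t2 := hk2 k g2 k0; have t3 := hk3 k g3 k0.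
rewrite expr0 mulr1 mul1r in t3.
have -> : eps / k%:R = eps / 2 / k%:R + eps / 2 / k%:R by field; rewrite gt_eqF.
rewrite -(mulrA (2 * C3)) -(mulrA 2 C3) in t2; exact: sum_bound b1 b4 b2 b3 t2 t3.
Qed.

End Final.

Local Open Scope classical_set_scope.
Local Open Scope ring_scope.

Theorem theorem1p4 (R : realType) (p : R) (hp : 1 / 2 < p) (hp1 : p <= 1) :
  exists2 c : R, 0 < c &
    (fun k : nat => 1 - Prob_subset (vertices k) p (@expanding_event R k c))
      =o_\oo (fun k : nat => k%:R^-1 : R).
Proof.
have p0 : 1 < 2 * p by lra.
have [c c0 hc] := expanding_fail_small p0 hp1.
exists c => //; apply/eqoP => eps eps0.
have [k0 hk] := hc eps eps0.
near=> k; have hk0 : (k0 <= k)%N by near: k; exists k0.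
have pge0 : 0 <= p by lra.
rewrite ger0_norm; last by rewrite Prob_compl // Prob_ge0.
by rewrite ger0_norm ?invr_ge0 //; apply: hk.
Unshelve. all: by end_near.
Qed.
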